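(* For every fixed $k\in\mathbb{Z}_{\geq 0}$, there is a polynomial-time algorithm that solves the Fault-Tolerant Path problem with parameter $k$ exactly on all instances whose graph $D$ is a directed acyclic graph.
   Context: Fault-Tolerant Path (FTP): given a directed graph $D=(V,A)$ with non-negative arc weights $w$, two vertices $s,t\in V$, a set $M\subseteq A$ of vulnerable arcs and an integer $k\in\mathbb{Z}_{\geq 0}$, find a minimum-weight set $S\subseteq A$ such that $S\setminus F$ contains an $s$-$t$ path for every $F\subseteq M$ with $|F|\leq k$. *)

(* Defs.v *)
From mathcomp Require Import all_boot all_order all_algebra.
From Stdlib Require Import BinNums.

Set Implicit Arguments.
Unset Strict Implicit.
Unset Printing Implicit Defensive.

Import Order.TTheory GRing.Theory Num.Theory.

(** * Model of computation

    The WHILE language of N. D. Jones (Computability and Complexity from a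
    Programming Perspective, MIT Press, 1997) over binary trees. Time is charged
    more severely than by unit cost: evaluating an expression costs the total
    size of all the trees produced on the way, so no run can build a tree larger
    than its cost. A Turing machine therefore simulates a run, and conversely is
    simulated by a WHILE program, with polynomial overhead. *)

Inductive tree := Leaf | Node of tree & tree.

Fixpoint tree_size (t : tree) : nat :=
  if t is Node l r then (tree_size l + tree_size r).+1 else 1.

Fixpoint tree_eqb (t u : tree) : bool :=
  match t, u with
  | Leaf, Leaf => true
  | Node t1 t2, Node u1 u2 => tree_eqb t1 u1 && tree_eqb t2 u2
  | _, _ => false
  end.

(* As truth values, Leaf is false and every other tree is true. *)
Definition tree_of_bool (b : bool) : tree := if b then Node Leaf Leaf else Leaf.
Definition is_true_tree (t : tree) : bool := if t is Leaf then false else true.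

Inductive expr :=
  | EVar of nat
  | ENil
  | ECons of expr & expr
  | EHd of expr
  | ETl of expr
  | EEq of expr & expr.

Inductive prog :=
  | Assign of nat & expr
  | Seq of prog & prog
  | If of expr & prog & prog
  | While of expr & prog.

Definition store := nat -> tree.

Definition update (s : store) (x : nat) (t : tree) : store :=
  fun y => if y == x then t else s y.

Fixpoint eval (s : store) (e : expr) : tree :=
  match e with
  | EVar x => s x
  | ENil => Leaf
  | ECons e1 e2 => Node (eval s e1) (eval s e2)
  | EHd e1 => if eval s e1 is Node l _ then l else Leaf
  | ETl e1 => if eval s e1 is Node _ r then r else Leaf
  | EEq e1 e2 => tree_of_bool (tree_eqb (eval s e1) (eval s e2))
  end.

Fixpoint eval_cost (s : store) (e : expr) : nat :=
  tree_size (eval s e) +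
  match e with
  | EVar _ | ENil => 0
  | EHd e1 | ETl e1 => eval_cost s e1
  | ECons e1 e2 | EEq e1 e2 => eval_cost s e1 + eval_cost s e2
  end.

(* [exec c s n s']: from store s, program c halts in store s' at cost n. *)
Inductive exec : prog -> store -> nat -> store -> Prop :=
  | exec_assign x e s :
      exec (Assign x e) s (eval_cost s e).+1 (update s x (eval s e))
  | exec_seq c1 c2 s s1 s2 n1 n2 :
      exec c1 s n1 s1 -> exec c2 s1 n2 s2 ->
      exec (Seq c1 c2) s (n1 + n2).+1 s2
  | exec_if e c1 c2 s s' n :
      exec (if is_true_tree (eval s e) then c1 else c2) s n s' ->
      exec (If e c1 c2) s (eval_cost s e + n).+1 s'
  | exec_while_stop e c s :
      is_true_tree (eval s e) = false ->
      exec (While e c) s (eval_cost s e).+1 s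
  | exec_while_step e c s s1 s2 n1 n2 :
      is_true_tree (eval s e) = true ->
      exec c s n1 s1 -> exec (While e c) s1 n2 s2 ->
      exec (While e c) s (eval_cost s e + n1 + n2).+1 s2.

(* Variable 0 holds the input at the start and the output at the end. *)
Definition init_store (input : tree) : store := update (fun=> Leaf) 0 input.

Definition computes_in (c : prog) (input : tree) (n : nat) (output : tree) : Prop :=
  exists s : store, exec c (init_store input) n s /\ s 0 = output.

(* One program and one polynomial bound serve all instances in [dom];
   [sol i out] says that out is a correct answer for the instance i. *)
Definition poly_time_solvable (I : Type) (encode : I -> tree)
    (dom : I -> Prop) (sol : I -> tree -> Prop) : Prop :=
  exists (c : prog) (a d : nat), forall i : I, dom i ->
    exists (n : nat) (out : tree),
      [/\ computes_in c (encode i) n out,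
          n <= a * tree_size (encode i) ^ d + a
        & sol i out].

(** * Encodings *)

Definition tree_of_seq (T : Type) (f : T -> tree) (s : seq T) : tree :=
  foldr (fun x t => Node (f x) t) Leaf s.

(* Binary digits, least significant first; 0 has no digits. *)
Fixpoint bits_of_pos (p : positive) : seq bool :=
  match p with
  | xH => [:: true]
  | xO q => false :: bits_of_pos q
  | xI q => true :: bits_of_pos q
  end.

Definition bits_of_nat (n : nat) : seq bool :=
  if bin_of_nat n is Npos p then bits_of_pos p else [::].

Definition tree_of_nat (n : nat) : tree :=
  tree_of_seq tree_of_bool (bits_of_nat n).

(* For nonnegative rationals only: the sign is dropped. *)
Definition tree_of_nnrat (q : rat) : tree :=
  Node (tree_of_nat `|numq q|%N) (tree_of_nat `|denq q|%N).

(** * The Fault-Tolerant Path problem *)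

(* Arcs are indexed, so parallel arcs are allowed. *)
Record ftp_instance := FtpInstance {
  nverts : nat;
  narcs : nat;
  arc_tail : 'I_narcs -> 'I_nverts;
  arc_head : 'I_narcs -> 'I_nverts;
  weight : 'I_narcs -> rat;
  weight_ge0 : forall a, (0 <= weight a)%R;
  source : 'I_nverts;
  target : 'I_nverts;
  vulnerable : {set 'I_narcs}
}.

Definition adj (D : ftp_instance) (X : {set 'I_(narcs D)}) : rel 'I_(nverts D) :=
  fun u v => [exists a in X, (arc_tail a == u) && (arc_head a == v)].

Definition acyclic (D : ftp_instance) : Prop :=
  forall c : seq 'I_(nverts D), ucycle (adj [set: 'I_(narcs D)]) c -> c = [::].

Definition contains_st_path (D : ftp_instance) (X : {set 'I_(narcs D)}) : Prop :=
  exists p : seq 'I_(nverts D),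
    [/\ path (adj X) (source D) p,
        last (source D) p = target D
      & uniq (source D :: p)].

Definition feasible (k : nat) (D : ftp_instance) (S : {set 'I_(narcs D)}) : Prop :=
  forall F : {set 'I_(narcs D)},
    F \subset vulnerable D -> #|F| <= k -> contains_st_path (S :\: F).

Definition total_weight (D : ftp_instance) (S : {set 'I_(narcs D)}) : rat :=
  (\sum_(a in S) weight a)%R.

Definition optimal (k : nat) (D : ftp_instance) (S : {set 'I_(narcs D)}) : Prop :=
  feasible k S /\
  forall S' : {set 'I_(narcs D)},
    feasible k S' -> (total_weight S <= total_weight S')%R.

(* The list of vertex names, the two terminals, and the list of arcs. *)
Definition encode_arc (D : ftp_instance) (a : 'I_(narcs D)) : tree :=
  Node (tree_of_nat (arc_tail a))
    (Node (tree_of_nat (arc_head a))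
      (Node (tree_of_bool (a \in vulnerable D)) (tree_of_nnrat (weight a)))).

Definition encode_instance (D : ftp_instance) : tree :=
  Node (tree_of_seq (fun v : 'I_(nverts D) => tree_of_nat v) (enum 'I_(nverts D)))
    (Node (tree_of_nat (source D))
      (Node (tree_of_nat (target D))
        (tree_of_seq (@encode_arc D) (enum 'I_(narcs D))))).

(* An arc set is answered by its characteristic list, in the order of the arcs
   in the input; the answer Leaf means that no arc set is feasible. *)
Definition encode_answer (D : ftp_instance) (S : option {set 'I_(narcs D)}) : tree :=
  if S is Some X then
    Node Leaf (tree_of_seq (fun a => tree_of_bool (a \in X)) (enum 'I_(narcs D)))
  else Leaf.

Definition ftp_solution (k : nat) (D : ftp_instance) (out : tree) : Prop :=
  (exists S : {set 'I_(narcs D)}, optimal k S /\ out = encode_answer (Some S))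
  \/ ((forall S : {set 'I_(narcs D)}, ~ feasible k S)
      /\ out = @encode_answer D None).

(* Main.v *)
From HB Require Import structures.
From mathcomp Require Import all_boot all_order all_algebra.
From mathcomp Require Import zify ring.
Require Import Defs.

(** By max-flow min-cut, an arc set is feasible exactly when it carries an integral
    s-t flow of value k+1 in which every vulnerable arc has capacity 1 and every safe
    arc is unbounded. So the task is to move k+1 tokens from s to t, paying once for
    each arc used and letting at most one token through a vulnerable arc. In an acyclic
    graph the arcs can be scanned so that all arcs into a vertex precede all arcs out of
    it; a dynamic program then goes through the arcs once, chooses how many of the tokens
    waiting at the tail of an arc move along it, and keeps the cheapest way to reach each
    of the at most (m+1)^(k+1) token configurations.

    Feasibility of the answer is a cut argument: if the arcs of F are removed and t is no
    longer reachable, then every token had to cross an arc of F out of the set of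
    reachable vertices, one token per arc, so |F| > k. Optimality follows by steering the
    dynamic program along a flow in a given feasible set.

    For the running time, the functions computed by WHILE programs in polynomial time are
    shown to be closed under composition, pairing, conditionals, and folds along lists
    whose intermediate results stay polynomially small; the algorithm is a functional
    program built from these. *)

Set Implicit Arguments.
Unset Strict Implicit.
Unset Printing Implicit Defensive.
Import Order.TTheory GRing.Theory Num.Theory.

(** * Types encoded as binary trees *)

Structure encType := EncType { enc_sort :> Type; enc : enc_sort -> tree }.

(** The instances build the shapes used by [encode_instance] and [encode_answer], so the final
    program reads and writes exactly these trees. Injectivity is left out of the structure and
    proved where equality is tested. *)
Canonical tree_encType := EncType (@id tree).
Canonical bool_encType := EncType tree_of_bool.
Canonical prod_encType (A B : encType) :=
  EncType (fun p : A * B => Node (enc p.1) (enc p.2)).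
Canonical seq_encType (A : encType) := EncType (tree_of_seq (@enc A)).
Canonical option_encType (A : encType) :=
  EncType (fun o : option A => if o is Some x then Node Leaf (enc x) else Leaf).

Definition esize (A : encType) (x : A) : nat := tree_size (enc x).

(** * Polynomially bounded measures *)

(** The successor keeps the base positive, so raising the exponent only weakens a bound; sums and
    products then just add up the exponents. *)
Definition pb (A : encType) (g : A -> nat) : Prop :=
  exists a d, forall x, g x <= a * (esize x).+1 ^ d.

Section PolyBounds.
Variables (A : encType).
Implicit Types g h : A -> nat.

Lemma pb_le g h : (forall x, g x <= h x) -> pb h -> pb g.
Proof. by move=> gh [a [d hb]]; exists a, d => x; apply: leq_trans (gh x) (hb x). Qed.

Lemma pb_const c : pb (fun _ : A => c).
Proof. by exists c, 0 => x; rewrite expn0 muln1. Qed.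

Lemma pb_esize : pb (fun x : A => esize x).
Proof. by exists 1, 1 => x; rewrite expn1 mul1n. Qed.

Lemma pb_add g h : pb g -> pb h -> pb (fun x => g x + h x).
Proof.
move=> [a [d ga]] [b [e hb]]; exists (a + b), (d + e) => x.
rewrite mulnDl; apply: leq_add.
  by apply: leq_trans (ga x) _; rewrite leq_mul2l leq_pexp2l ?orbT ?leq_addr.
by apply: leq_trans (hb x) _; rewrite leq_mul2l leq_pexp2l ?orbT ?leq_addl.
Qed.

Lemma pb_mul g h : pb g -> pb h -> pb (fun x => g x * h x).
Proof.
move=> [a [d ga]] [b [e hb]]; exists (a * b), (d + e) => x.
by rewrite expnD mulnACA leq_mul.
Qed.

Lemma pb_succ g : pb g -> pb (fun x => (g x).+1).
Proof.
by move=> pg; apply: (@pb_le _ (fun x => g x + 1)) => [x|]; [lia|apply: pb_add (pb_const _)].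
Qed.

Lemma pb_exp g d : pb g -> pb (fun x => g x ^ d).
Proof.
move=> pg; elim: d => [|d IHd]; first exact: pb_const.
by apply: (@pb_le _ (fun x => g x * g x ^ d)) => [x|]; [rewrite expnS|apply: pb_mul].
Qed.

Lemma pb_subst (B : encType) (f : A -> B) (g : B -> nat) :
  pb g -> pb (fun x => esize (f x)) -> pb (fun x => g (f x)).
Proof.
move=> [a [d ga]] pf.
apply: (@pb_le _ (fun x => a * (esize (f x)).+1 ^ d)) => [x|]; first exact: ga.
by apply: pb_mul (pb_const _) _; apply: pb_exp; apply: pb_succ.
Qed.

End PolyBounds.

Arguments pb_const {A} c.
Arguments pb_esize {A}.

(** * Polynomial-time functions *)

(** Total correctness with a time bound. An upper bound in place of the exact cost allows weakening
    when programs are composed. *)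
Definition runs (c : prog) (s : store) (t : nat) (Q : store -> Prop) : Prop :=
  exists n s', [/\ exec c s n s', n <= t & Q s'].

Lemma runs_weaken c s t t' (Q Q' : store -> Prop) :
  runs c s t Q -> t <= t' -> (forall s', Q s' -> Q' s') -> runs c s t' Q'.
Proof.
move=> [n [s' [e le q]]] tt QQ; exists n, s'; split=> //; last exact: QQ.
exact: leq_trans le tt.
Qed.

Lemma runs_assign x e s (Q : store -> Prop) :
  Q (update s x (eval s e)) -> runs (Assign x e) s (eval_cost s e).+1 Q.
Proof. by move=> q; do 2 eexists; split; [apply: exec_assign| |exact: q]. Qed.

Lemma runs_seq c1 c2 s t1 t2 (Q : store -> Prop) :
  runs c1 s t1 (fun s1 => runs c2 s1 t2 Q) -> runs (Seq c1 c2) s (t1 + t2).+1 Q.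
Proof.
move=> [n1 [s1 [e1 l1 [n2 [s2 [e2 l2 q]]]]]].
exists (n1 + n2).+1, s2; split=> //; first exact: exec_seq e1 e2.
by rewrite ltnS leq_add.
Qed.

Lemma runs_if e c1 c2 s t (Q : store -> Prop) :
  runs (if is_true_tree (eval s e) then c1 else c2) s t Q ->
  runs (If e c1 c2) s (eval_cost s e + t).+1 Q.
Proof.
move=> [n [s' [ex le q]]]; exists (eval_cost s e + n).+1, s'; split=> //.
  exact: exec_if.
by rewrite ltnS leq_add2l.
Qed.

Lemma runs_while_stop e c s (Q : store -> Prop) :
  is_true_tree (eval s e) = false -> Q s -> runs (While e c) s (eval_cost s e).+1 Q.
Proof. by move=> ef q; do 2 eexists; split; [apply: exec_while_stop| |exact: q]. Qed.

Lemma runs_while_step e c s t1 t2 (Q : store -> Prop) :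
  is_true_tree (eval s e) -> runs c s t1 (fun s1 => runs (While e c) s1 t2 Q) ->
  runs (While e c) s (eval_cost s e + t1 + t2).+1 Q.
Proof.
move=> et [n1 [s1 [e1 l1 [n2 [s2 [e2 l2 q]]]]]].
exists (eval_cost s e + n1 + n2).+1, s2; split=> //.
  exact: exec_while_step et e1 e2.
by rewrite ltnS !leq_add.
Qed.

(* Only variable 0 carries data in and out; variables from [N] on are preserved,
   so that they can hold the values saved by a surrounding program. *)
Definition PT (A B : encType) (f : A -> B) : Prop :=
  exists (c : prog) (N : nat) (t : A -> nat), pb t /\
  forall x s, s 0 = enc x ->
    runs c s (t x) (fun s' => s' 0 = enc (f x) /\ forall y, N <= y -> s' y = s y).

Lemma tree_size_gt0 t : 0 < tree_size t.
Proof. by case: t. Qed.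

Lemma eval_size s e : tree_size (eval s e) <= eval_cost s e.
Proof. by case: e => *; apply: leq_addr. Qed.

(** An assignment stores a tree no larger than the cost of evaluating it, so the growth of every
    variable is paid for by the running time. *)
Lemma exec_size c s n s' : exec c s n s' -> forall y, tree_size (s' y) <= tree_size (s y) + n.
Proof.
elim=> {c s n s'}.
- move=> x e s y; rewrite /update; case: eqP => _; last by rewrite leq_addr.
  by have := eval_size s e; lia.
- by move=> c1 c2 s s1 s2 n1 n2 _ I1 _ I2 y; have := I1 y; have := I2 y; lia.
- by move=> e c1 c2 s s' n _ I y; have := I y; lia.
- by move=> e c s _ y; lia.
- by move=> e c s s1 s2 n1 n2 _ _ I1 _ I2 y; have := I1 y; have := I2 y; lia.
Qed.

#[local] Arguments update : simpl never.

Lemma update_eq s x t : update s x t x = t.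
Proof. by rewrite /update eqxx. Qed.

Lemma update_neq s x t y : y <> x -> update s x t y = s y.
Proof. by rewrite /update; case: eqP. Qed.

Lemma runs_copy x y v s : s y = v ->
  runs (Assign x (EVar y)) s (tree_size v).+1 (fun s' => s' = update s x v).
Proof.
move=> <-; have := @runs_assign x (EVar y) s (fun s' => s' = update s x (s y)) erefl.
by rewrite /= addn0.
Qed.

Section Closure.
Variables (A B C : encType).

(** Needed for composition: the second program runs on an output whose size is at most that of the
    input plus the time of the first program. *)
Lemma PT_size (f : A -> B) : PT f -> pb (fun x => esize (f x)).
Proof.
move=> [c [N [t [pt run]]]]; apply: (@pb_le _ _ (fun x => esize x + t x)).
  move=> x; have [n [s' [e le [s0 _]]]] := run x (fun=> enc x) erefl.
  by rewrite /esize -s0; apply: leq_trans (exec_size e 0) _; rewrite leq_add2l.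
exact: pb_add pb_esize pt.
Qed.

Lemma pb_comp (f : A -> B) (g : B -> nat) : PT f -> pb g -> pb (fun x => g (f x)).
Proof. by move=> /PT_size pf pg; apply: pb_subst. Qed.

Lemma PT_comp (g : B -> C) (f : A -> B) : PT g -> PT f -> PT (fun x => g (f x)).
Proof.
move=> [cg [Ng [tg [pg rg]]]] pf; have [cf [Nf [tf [pf' rf]]]] := pf.
exists (Seq cf cg), (maxn Nf Ng), (fun x => (tf x + tg (f x)).+1); split.
  by apply: pb_succ; apply: pb_add => //; apply: pb_comp.
move=> x s s0; apply: runs_seq; apply: runs_weaken (rf x s s0) _ _ => // s1 [s10 fr1].
apply: runs_weaken (rg _ s1 s10) _ _ => // s2 [s20 fr2]; split=> // y.
by rewrite geq_max => /andP[y1 y2]; rewrite fr2 // fr1.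
Qed.

Lemma PT_assign (f : A -> B) e :
  (forall s x, s 0 = enc x -> eval s e = enc (f x)) ->
  (exists2 t : A -> nat, pb t & forall s x, s 0 = enc x -> eval_cost s e <= t x) -> PT f.
Proof.
move=> ev [t pt le]; exists (Assign 0 e), 1, (fun x => (t x).+1); split; first exact: pb_succ.
move=> x s s0; apply: (@runs_weaken _ _ (eval_cost s e).+1 _ (fun s' => s' = update s 0 (eval s e))).
- exact: runs_assign.
- exact: le.
- move=> _ ->; rewrite update_eq (ev _ _ s0); split=> // y y0.
  by rewrite update_neq //; lia.
Qed.

End Closure.

Lemma PT_ext (A B : encType) (f g : A -> B) :
  (forall x, f x = g x) -> PT f -> PT g.
Proof.
move=> fg [c [N [t [pt rf]]]]; exists c, N, t; split=> // x s s0.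
by rewrite -fg; apply: rf.
Qed.

(** Programs see only trees, so types whose values have the same encodings are interchangeable: a
    nonempty list is a pair, and so is [Some x]. *)
Lemma PT_enc_ext (A B C : encType) (f : A -> B) (g : A -> C) :
  (forall x, enc (f x) = enc (g x)) -> PT f -> PT g.
Proof.
move=> fg [c [N [t [pt rf]]]]; exists c, N, t; split=> // x s s0.
by rewrite -fg; apply: rf.
Qed.

Fixpoint expr_of_tree (t : tree) : expr :=
  if t is Node l r then ECons (expr_of_tree l) (expr_of_tree r) else ENil.

Lemma eval_expr_of_tree s t : eval s (expr_of_tree t) = t.
Proof. by elim: t => //= l -> r ->. Qed.

Lemma eval_cost_expr_of_tree s s' t :
  eval_cost s (expr_of_tree t) = eval_cost s' (expr_of_tree t).
Proof. by elim: t => //= l -> r ->; rewrite !eval_expr_of_tree. Qed.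

Ltac pb_auto := repeat first [assumption | apply: pb_const | apply: pb_add | apply: pb_mul
  | apply: pb_esize | apply: pb_succ | exact: PT_size | apply: pb_exp].

(** * Constants, pairs and conditionals *)

Section Basics.
Variables (A B C X : encType).

Lemma PT_id : PT (fun x : A => x).
Proof.
apply: (@PT_assign _ _ _ (EVar 0)) => //=; exists (fun x => esize x); first exact: pb_esize.
by move=> s x /= ->; rewrite addn0.
Qed.

Lemma PT_const (b : B) : PT (fun _ : A => b).
Proof.
apply: (@PT_assign _ _ _ (expr_of_tree (enc b))) => [s x _|].
  exact: eval_expr_of_tree.
exists (fun=> eval_cost (fun=> Leaf) (expr_of_tree (enc b))); first exact: pb_const.
by move=> s x _; rewrite (eval_cost_expr_of_tree _ (fun=> Leaf)).
Qed.

Lemma PT_fst_ : PT (@fst A B).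
Proof.
apply: (@PT_assign _ _ _ (EHd (EVar 0))) => [s x /= -> //|].
exists (fun x => esize x + esize x); first by apply: pb_add; apply: pb_esize.
by move=> s x /= ->; rewrite /esize /=; lia.
Qed.

Lemma PT_snd_ : PT (@snd A B).
Proof.
apply: (@PT_assign _ _ _ (ETl (EVar 0))) => [s x /= -> //|].
exists (fun x => esize x + esize x); first by apply: pb_add; apply: pb_esize.
by move=> s x /= ->; rewrite /esize /=; lia.
Qed.

Lemma PT_fst (f : X -> A * B) : PT f -> PT (fun x => (f x).1).
Proof. by apply: PT_comp; apply: PT_fst_. Qed.

Lemma PT_snd (f : X -> A * B) : PT f -> PT (fun x => (f x).2).
Proof. by apply: PT_comp; apply: PT_snd_. Qed.

(** The input is saved in [M] and the first result in [M.+1], both beyond the variables that the two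
    programs may change. *)
Lemma PT_pair (f : X -> A) (g : X -> B) : PT f -> PT g -> PT (fun x => (f x, g x)).
Proof.
move=> pf pg; have [cf [Nf [tf [pf' rf]]]] := pf; have [cg [Ng [tg [pg' rg]]]] := pg.
pose M := (maxn Nf Ng).+1.
exists (Seq (Assign M (EVar 0)) (Seq cf (Seq (Assign M.+1 (EVar 0))
  (Seq (Assign 0 (EVar M)) (Seq cg (Assign 0 (ECons (EVar M.+1) (EVar 0)))))))), M.+2,
  (fun x => 20 + 3 * esize x + tf x + tg x + 4 * esize (f x) + 4 * esize (g x)); split.
  pb_auto.
move=> x s s0.
have x1 := tree_size_gt0 (enc x).
apply: (@runs_weaken _ _ _ _ (fun s' => s' 0 = enc (f x, g x) /\
   forall y, M.+2 <= y -> s' y = s y)); last by [].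
  apply: runs_seq; apply: runs_assign; rewrite /= s0.
  apply: runs_seq; apply: runs_weaken (rf x _ _) _ _ => //.
  move=> s1 [s10 fr1]; have {}s1M : s1 M = enc x.
    by rewrite fr1 ?update_eq // /M; lia.
  apply: runs_seq; apply: runs_weaken (runs_copy _ s10) _ _ => // _ ->.
  apply: runs_seq; apply: runs_weaken (@runs_copy _ M (enc x) _ _) _ _ => //.
    by rewrite update_neq ?s1M //; lia.
  move=> _ ->.
  apply: runs_seq; apply: runs_weaken (rg x _ _) _ _ => //.
  move=> s2 [s20 fr2]; have s2M : s2 M.+1 = enc (f x).
    by rewrite fr2 1?update_neq ?update_eq // /M; lia.
  apply: (@runs_weaken _ _ (2 * esize (f x) + 2 * esize (g x) + 2) _
    (fun s' => s' = update s2 0 (Node (enc (f x)) (enc (g x))))) => //.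
    have := @runs_assign 0 (ECons (EVar M.+1) (EVar 0)) s2.
    rewrite /= s2M s20 => /(_ _ erefl) h; apply: runs_weaken h _ _ => //.
    by rewrite /esize; lia.
  move=> _ ->; split; first by rewrite update_eq.
  move=> y yM; rewrite update_neq ?fr2 ?update_neq ?fr1 ?update_neq //; rewrite /M in yM *; lia.
by rewrite /esize /= s0; lia.
Qed.

Lemma PT_if (b : X -> bool) (f g : X -> A) :
  PT b -> PT f -> PT g -> PT (fun x => if b x then f x else g x).
Proof.
move=> [cb [Nb [tb [pb' rb]]]] [cf [Nf [tf [pf' rf]]]] [cg [Ng [tg [pg' rg]]]].
pose M := (maxn Nb (maxn Nf Ng)).+1.
exists (Seq (Assign M (EVar 0)) (Seq cb (If (EVar 0)
   (Seq (Assign 0 (EVar M)) cf) (Seq (Assign 0 (EVar M)) cg)))), M.+1,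
  (fun x => 20 + 3 * esize x + tf x + tg x + tb x); split.
  pb_auto.
move=> x s s0.
have bsz : tree_size (enc (b x)) <= 3 by case: (b x).
apply: (@runs_weaken _ _ _ _ (fun s' => s' 0 = enc (if b x then f x else g x) /\
   forall y, M.+1 <= y -> s' y = s y)); last by [].
  apply: runs_seq; apply: runs_assign; rewrite /= s0.
  apply: runs_seq; apply: runs_weaken (rb x _ _) _ _ => //.
  move=> s1 [s10 fr1]; have {}s1M : s1 M = enc x.
    by rewrite fr1 ?update_eq // /M; lia.
  have run0 : runs (Assign 0 (EVar M)) s1 (esize x).+1
    (fun s' => s' = update s1 0 (enc x)).
    exact: runs_copy.
  pose R := fun s' : store => s' 0 = enc (if b x then f x else g x) /\
       forall y, M.+1 <= y -> s' y = s y.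
  apply: (@runs_weaken _ _ (eval_cost s1 (EVar 0) + ((esize x).+1 + (tf x + tg x)).+1).+1
    (3 + ((esize x).+1 + (tf x + tg x)).+1).+1 R); last by [].
    2: by rewrite /= s10; lia.
  apply: runs_if.
  rewrite /= s10 /R; case: (b x) => /=; apply: runs_seq; apply: runs_weaken run0 _ _ => // _ ->.
  - apply: runs_weaken (rf x _ _) _ _ => //; first by rewrite leq_addr.
    move=> s2 [s20 fr2]; split=> // y yM; rewrite fr2 ?update_neq ?fr1 ?update_neq //; rewrite /M in yM *; lia.
  - apply: runs_weaken (rg x _ _) _ _ => //; first by rewrite leq_addl.
    move=> s2 [s20 fr2]; split=> // y yM; rewrite fr2 ?update_neq ?fr1 ?update_neq //; rewrite /M in yM *; lia.
by rewrite /= /esize s0; lia.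
Qed.

End Basics.

Arguments PT_id {A}.
Arguments PT_const {A B} b.

Lemma tree_eqbP : Equality.axiom tree_eqb.
Proof.
elim=> [|l IHl r IHr] [|l' r'] /=; try by constructor.
apply: (iffP andP) => [[/IHl<- /IHr<-] //|[<- <-]].
by split; [case: (IHl l)|case: (IHr r)].
Qed.

HB.instance Definition _ := hasDecEq.Build tree tree_eqbP.

Lemma enc_bool_inj : injective (@enc bool_encType).
Proof. by case=> [] []. Qed.

Lemma enc_prod_inj (A B : encType) : injective (@enc A) -> injective (@enc B) ->
  injective (@enc (prod_encType A B)).
Proof. by move=> iA iB [a b] [a' b'] [/iA-> /iB->]. Qed.

Lemma enc_seq_inj (A : encType) : injective (@enc A) -> injective (@enc (seq_encType A)).
Proof. by move=> iA; elim=> [|x s IH] [|y t] //= [/iA-> /IH->]. Qed.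

(** * Equality tests and basic list operations *)

Section Lists.
Variables (A B C X : encType).

Lemma PT_eq (f g : X -> A) (b : X -> bool) :
  (forall x, b x = (enc (f x) == enc (g x))) -> PT f -> PT g -> PT b.
Proof.
move=> bE pf pg; apply: PT_ext (fun x => esym (bE x)) _.
apply: (@PT_comp _ _ _ (fun p : A * A => enc p.1 == enc p.2) (fun x => (f x, g x))); last exact: PT_pair pf pg.
apply: (@PT_assign _ _ _ (EEq (EHd (EVar 0)) (ETl (EVar 0)))) => [s x /= -> /=|].
  by [].
exists (fun x => 4 * esize x + 3) => [|s x /= -> /=].
  by apply: pb_add (pb_const _); apply: pb_mul (pb_const _) pb_esize.
rewrite /esize /=; set e := tree_eqb _ _.
have : tree_size (tree_of_bool e) <= 3 by case: e.
by lia.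
Qed.

Lemma PT_not (b : X -> bool) : PT b -> PT (fun x => ~~ b x).
Proof.
move=> pb; apply: (@PT_ext _ _ (fun x => if b x then false else true)).
  by move=> x; case: (b x).
by apply: PT_if => //; apply: PT_const.
Qed.

Lemma PT_and (a b : X -> bool) : PT a -> PT b -> PT (fun x => a x && b x).
Proof. by move=> pa pb; apply: PT_if => //; apply: PT_const. Qed.

Lemma PT_cons (f : X -> A) (g : X -> seq A) : PT f -> PT g -> PT (fun x => f x :: g x).
Proof. by move=> pf pg; apply: PT_enc_ext (PT_pair pf pg). Qed.

Lemma PT_some (f : X -> A) : PT f -> PT (fun x => Some (f x)).
Proof. by move=> pf; apply: PT_enc_ext (PT_pair (PT_const Leaf) pf). Qed.

Lemma PT_behead (f : X -> seq A) : PT f -> PT (fun x => behead (f x)).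
Proof.
apply: PT_comp; apply: (@PT_assign _ _ _ (ETl (EVar 0))) => [s [|a l] /= -> //|].
exists (fun x => esize x + esize x); first by apply: pb_add; apply: pb_esize.
by move=> s [|a l] /= ->; rewrite /esize /=; lia.
Qed.

Lemma PT_nilp (f : X -> seq A) : PT f -> PT (fun x => nilp (f x)).
Proof.
apply: PT_comp; apply: (@PT_assign _ _ _ (EEq (EVar 0) ENil)) => [s [|a l] /= -> //|].
exists (fun x => esize x + 10); first by apply: pb_add (pb_const _); apply: pb_esize.
by move=> s [|a l] /= ->; rewrite /esize /=; lia.
Qed.

Lemma PT_head (a0 : A) (f : X -> seq A) : PT f -> PT (fun x => head a0 (f x)).
Proof.
apply: PT_comp.
exists (If (EVar 0) (Assign 0 (EHd (EVar 0))) (Assign 0 (expr_of_tree (enc a0)))), 1,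
  (fun x => 3 * esize x + 10 + eval_cost (fun=> Leaf) (expr_of_tree (enc a0))); split.
  by apply: pb_add (pb_const _); apply: pb_add (pb_const _); apply: pb_mul (pb_const _) pb_esize.
move=> x s s0.
pose Q := (fun s' : store => s' = update s 0 (enc (head a0 x))).
apply: (@runs_weaken _ _ (eval_cost s (EVar 0) + (2 * esize x + 3 +
  eval_cost (fun=> Leaf) (expr_of_tree (enc a0)))).+1 _ Q); last 2 first.
- by rewrite /= s0 /esize; lia.
- move=> _ ->; rewrite update_eq; split=> // y y0; rewrite update_neq //; lia.
apply: runs_if; rewrite /= s0 {}/Q; case: x s0 => [|a l] /= s0.
  apply: (@runs_weaken _ _ (eval_cost s (expr_of_tree (enc a0))).+1 _
    (fun s' => s' = update s 0 (enc a0))); last by [].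
    by apply: runs_assign; rewrite eval_expr_of_tree.
  by rewrite (eval_cost_expr_of_tree _ (fun=> Leaf)); lia.
apply: (@runs_weaken _ _ (eval_cost s (EHd (EVar 0))).+1 _
    (fun s' => s' = update s 0 (enc a))); last by [].
  by apply: runs_assign; rewrite /= s0.
by rewrite /= s0 /esize /=; lia.
Qed.

Lemma esize_nil : esize ([::] : seq A) = 1.
Proof. by []. Qed.

Lemma esize_cons (a : A) l : esize (a :: l) = (esize a + esize l).+1.
Proof. by []. Qed.

Lemma esize_pair (a : A) (b : B) : esize (a, b) = (esize a + esize b).+1.
Proof. by []. Qed.

Lemma esize_gt0 (a : A) : 0 < esize a.
Proof. exact: tree_size_gt0. Qed.

Lemma esize_seq (l : seq A) : esize l = (\sum_(a <- l) (esize a).+1).+1.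
Proof. by elim: l => [|a l IH]; rewrite ?big_nil // big_cons esize_cons IH addSn addnS. Qed.

Lemma esize_cat (l1 l2 : seq A) : (esize (l1 ++ l2)).+1 = esize l1 + esize l2.
Proof. by rewrite !esize_seq big_cat /=; lia. Qed.

Lemma size_le_esize (l : seq A) : size l < esize l.
Proof. by elim: l => [|a l IH] //; rewrite esize_cons /=; lia. Qed.

Lemma esize_seq_le (l : seq A) b n :
  all (fun a => esize a <= b) l -> size l <= n -> esize l <= n * b.+1 + 1.
Proof.
move=> lb ln; apply: (@leq_trans (size l * b.+1 + 1)); last by rewrite leq_add2r leq_mul2r ln orbT.
elim: l {n ln} lb => [|a l IH] /=; first by rewrite esize_nil.
by case/andP=> ab /IH; rewrite esize_cons mulSn; lia.
Qed.

End Lists.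

(** * Folds with bounded intermediate results *)

Section Fold.
Variables (A B X : encType).
Variables (l : X -> seq A) (b0 : X -> B) (step : X -> B -> A -> B) (bd : X -> nat).
Hypotheses (pl : PT l) (pb0 : PT b0).
Hypothesis (pstep : PT (fun p : A * (B * X) => step p.2.2 p.2.1 p.1)).
Hypothesis (pbd : pb bd).
Hypothesis (bdP : forall x l1 l2, l x = l1 ++ l2 ->
  esize (foldl (step x) (b0 x) l1) <= bd x).

(** The variables [M], [M.+1] and [M.+2] hold the rest of the list, the accumulator and the input. A
    polynomial-time step alone could double the accumulator in every round; [bdP] bounds it after
    every prefix, so all rounds share the time bound [K x]. *)
Lemma PT_foldl : PT (fun x => foldl (step x) (b0 x) (l x)).
Proof.
have [cl [Nl [tl [pl' rl]]]] := pl; have [cb [Nb [tb [pb' rb]]]] := pb0.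
have [cs [Ns [ts [[sa [sd tsb]] rs]]]] := pstep.
pose M := (maxn Nl (maxn Nb Ns)).+1.
pose body := Seq (Assign 0 (ECons (EHd (EVar M)) (ECons (EVar M.+1) (EVar M.+2))))
  (Seq cs (Seq (Assign M.+1 (EVar 0)) (Assign M (ETl (EVar M))))).
(* [Z x] bounds the size of the argument handed to the step, so [sa * (Z x) ^ sd] bounds its time;
   [20 * Z x] covers the copying around it. *)
pose Z x := esize (l x) + bd x + esize x + 10.
pose K x := sa * (Z x) ^ sd + 20 * Z x.
have loop x l1 l2 s : l x = l1 ++ l2 -> s M = enc l2 ->
    s M.+1 = enc (foldl (step x) (b0 x) l1) -> s M.+2 = enc x ->
  runs (While (EVar M) body) s ((size l2).+1 * K x)
    (fun s' => s' M.+1 = enc (foldl (step x) (b0 x) (l x)) /\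
       forall y, M.+3 <= y -> s' y = s y).
  elim: l2 l1 s => [|a l2 IH] l1 s lx sM sM1 sM2.
    pose Q := fun s' => s' = s.
    apply: (@runs_weaken _ _ (eval_cost s (EVar M)).+1 _ Q).
    - by apply: runs_while_stop; rewrite //= sM.
    - by rewrite /= sM mul1n /K /Z /=; lia.
    - by move=> _ ->; rewrite lx cats0.
  have bacc : esize (foldl (step x) (b0 x) l1) <= bd x by apply: bdP lx.
  have bacc' : esize (foldl (step x) (b0 x) (rcons l1 a)) <= bd x.
    by apply: (@bdP _ _ l2); rewrite cat_rcons.
  have lxa : esize (a :: l2) <= esize (l x).
    by rewrite lx; have := esize_cat l1 (a :: l2); have := esize_gt0 l1; lia.
  rewrite esize_cons in lxa.
  pose v := (a, (foldl (step x) (b0 x) l1, x)).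
  have tv : ts v <= sa * (Z x) ^ sd.
    apply: leq_trans (tsb v) _; rewrite leq_mul2l; apply/orP; right; case: (sd) => // d.
    rewrite leq_exp2r //; by rewrite /v !esize_pair /Z; lia.
  rewrite mulSn; pose R := (fun s' => s' M.+1 = enc (foldl (step x) (b0 x) (l x)) /\
       forall y, M.+3 <= y -> s' y = s y).
  (* The loop test costs at most the size of the whole list; that share of [K x] is set aside and
     the rest is left for the body. *)
  have KE : (eval_cost s (EVar M) + (K x - (esize (l x)).+1) + (size l2).+1 * K x).+1
     <= K x + (size l2).+1 * K x.
    rewrite /= sM -/(esize (a :: l2)) esize_cons /K /Z; lia.
  apply: runs_weaken KE (fun s' (h : R s') => h).
  apply: runs_while_step; first by rewrite /= sM.
  rewrite /body.
  have cE : eval_cost s (ECons (EHd (EVar M)) (ECons (EVar M.+1) (EVar M.+2))) <= 6 * Z x.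
    rewrite /= sM sM1 sM2 /= -!/(esize _) /Z; lia.
  have eE : eval s (ECons (EHd (EVar M)) (ECons (EVar M.+1) (EVar M.+2))) = enc v.
    by rewrite /= sM sM1 sM2.
  pose s1 := update s 0 (enc v).
  pose W := fun s' => runs (While (EVar M) body) s' ((size l2).+1 * K x) R.
  apply: (@runs_weaken _ _ ((6 * Z x).+1 + (ts v + ((bd x).+1 + (2 * Z x).+1).+1).+1).+1 _ W) => //;
    last by rewrite /K; rewrite /Z in tv cE *; lia.
  apply: runs_seq.
  apply: (@runs_weaken _ _ _ _ (fun s' => s' = s1)).
  + by apply: runs_assign; rewrite eE.
  + by rewrite ltnS.
  move=> _ ->; apply: runs_seq; apply: runs_weaken (rs v s1 _) _ _ => // s2 [s20 fr2].
  have s2y y : M <= y -> s2 y = s y.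
    by move=> yM; rewrite fr2 /s1 ?update_neq //; rewrite /M in yM *; lia.
  apply: runs_seq; apply: runs_weaken (runs_copy _ s20) _ _ => // [|_ ->].
    by rewrite ltnS; move: bacc'; rewrite foldl_rcons.
  have [s3 s3E] : {s3 | s3 = update s2 M.+1 (enc (step x (foldl (step x) (b0 x) l1) a))} by eexists.
  rewrite /= -s3E.
  have s3M : s3 M = enc (a :: l2) by rewrite s3E update_neq ?s2y //; lia.
  apply: (@runs_weaken _ _ _ _ (fun s' => s' = update s3 M (enc l2))).
  + by apply: runs_assign; rewrite /= s3M.
  + by rewrite /= s3M /= -!/(esize _) /Z; lia.
  move=> _ ->; rewrite /W.
  apply: runs_weaken (IH (rcons l1 a) _ _ _ _ _) _ _ => //.
  + by rewrite cat_rcons.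
  + by rewrite update_eq.
  + by rewrite update_neq ?s3E ?update_eq ?foldl_rcons //; lia.
  + by rewrite update_neq ?s3E ?update_neq ?s2y //; lia.
  move=> s' [s'M fr]; split=> // y yM.
  by rewrite fr // update_neq ?s3E ?update_neq ?s2y //; lia.
exists (Seq (Assign M.+2 (EVar 0)) (Seq cl (Seq (Assign M (EVar 0)) (Seq (Assign 0 (EVar M.+2))
  (Seq cb (Seq (Assign M.+1 (EVar 0)) (Seq (While (EVar M) body) (Assign 0 (EVar M.+1))))))))), M.+3,
  (fun x => 30 + 2 * esize x + tl x + esize (l x) + tb x + 2 * bd x + (esize (l x)).+1 * K x); split.
  have pK : pb K.
    rewrite /K /Z; pb_auto.
  pb_auto.
move=> x s s0.
pose R := (fun s' => s' 0 = enc (foldl (step x) (b0 x) (l x)) /\ forall y, M.+3 <= y -> s' y = s y).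
apply: (@runs_weaken _ _ _ _ R); last by [].
  apply: runs_seq; apply: runs_weaken (runs_copy _ s0) _ _ => // _ ->.
  apply: runs_seq; apply: runs_weaken (rl x _ _) _ _ => // s1 [s10 fr1].
  have s1M : s1 M.+2 = enc x by rewrite fr1 ?update_eq // /M; lia.
  apply: runs_seq; apply: runs_weaken (runs_copy _ s10) _ _ => // _ ->.
  have s2M : update s1 M (enc (l x)) M.+2 = enc x by rewrite update_neq //; lia.
  apply: runs_seq; apply: runs_weaken (runs_copy _ s2M) _ _ => // _ ->.
  apply: runs_seq; apply: runs_weaken (rb x _ _) _ _ => // s3 [s30 fr3].
  have s3y y : M <= y -> s3 y = update (update s1 M (enc (l x))) 0 (enc x) y.
    by move=> yM; rewrite fr3 //; rewrite /M in yM *; lia.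
  apply: runs_seq; apply: runs_weaken (runs_copy _ s30) _ _ => // _ ->.
  apply: runs_seq; apply: runs_weaken (@loop x [::] (l x) _ erefl _ _ _) _ _ => //.
  + by rewrite update_neq ?s3y 1?update_neq ?update_eq //; lia.
  + by rewrite update_eq.
  + by rewrite update_neq ?s3y ?update_neq ?s1M //; lia.
  move=> s4 [s4M fr4]; apply: runs_weaken (runs_copy _ s4M) _ _ => // _ ->.
  split; rewrite ?update_eq // => y yM.
  by rewrite update_neq ?fr4 ?update_neq ?s3y ?update_neq ?fr1 ?update_neq //; rewrite /M in yM *; lia.
have b1 : tree_size (enc (b0 x)) <= bd x := @bdP x [::] _ erefl.
have := @bdP x (l x) [::]; rewrite cats0 => /(_ erefl).
have := leq_mul (size_le_esize (l x)) (leqnn (K x)).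
by rewrite /esize !mulSn; lia.
Qed.

End Fold.

(** * List functions obtained from folds *)

Section DerivedLists.
Variables (A B C X : encType).

Lemma PT_app2 (h : A -> B -> C) (f : X -> A) (g : X -> B) :
  PT (fun p : A * B => h p.1 p.2) -> PT f -> PT g -> PT (fun x => h (f x) (g x)).
Proof.
move=> ph pf pg.
exact: (@PT_comp _ _ _ (fun p : A * B => h p.1 p.2) (fun x => (f x, g x)) ph (PT_pair pf pg)).
Qed.

Lemma PT_iter n (f : A -> A) (g : X -> A) : PT f -> PT g -> PT (fun x => iter n f (g x)).
Proof. by move=> pf pg; elim: n => //= n IH; apply: PT_comp IH. Qed.

Lemma PT_nseq n (f : X -> A) : PT f -> PT (fun x => nseq n (f x)).
Proof.
by move=> pf; elim: n => [|n IH]; [apply: PT_const|apply: PT_cons].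
Qed.

Lemma esize_catrev (s t : seq A) : (esize (catrev s t)).+1 = esize s + esize t.
Proof. by elim: s t => [|a s IH] t //=; rewrite IH !esize_cons; lia. Qed.

Lemma foldl_catrev (s t : seq A) : foldl (fun acc a => a :: acc) t s = catrev s t.
Proof. by elim: s t => /=. Qed.

Lemma PT_catrev (f g : X -> seq A) : PT f -> PT g -> PT (fun x => catrev (f x) (g x)).
Proof.
move=> pf pg; apply: (@PT_ext _ _ _ _ (fun x => foldl_catrev (f x) (g x))).
apply: (@PT_foldl _ _ _ f g (fun _ acc a => a :: acc) (fun x => esize (f x) + esize (g x))) => //.
- by apply: PT_cons; [apply: PT_fst PT_id|apply/PT_fst/PT_snd/PT_id].
- pb_auto.
move=> x l1 l2 fx; rewrite foldl_catrev.
have := esize_catrev l1 (g x); have := esize_cat l1 l2; have := esize_gt0 l2; rewrite fx; lia.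
Qed.

Lemma PT_rev (f : X -> seq A) : PT f -> PT (fun x => rev (f x)).
Proof. by move=> pf; apply: PT_catrev pf (PT_const _). Qed.

Lemma PT_cat (f g : X -> seq A) : PT f -> PT g -> PT (fun x => f x ++ g x).
Proof.
move=> pf pg; apply: (@PT_ext _ _ (fun x => catrev (rev (f x)) (g x))).
  by move=> x; rewrite catrevE revK.
by apply: PT_catrev pg; apply: PT_rev.
Qed.

End DerivedLists.

Section Flatmap.
Variables (A B X : encType).

Lemma foldl_flatten (f : A -> seq B) s t :
  foldl (fun acc a => catrev (f a) acc) t s = catrev (flatten [seq f a | a <- s]) t.
Proof.
elim: s t => //= a s IH t; by rewrite IH !catrevE rev_cat catA.
Qed.

(** Each block is reversed onto the accumulator, and one reversal at the end restores the order.
    Map, filter and [has] are derived from this. *)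
Lemma PT_flatmap (f : X -> A -> seq B) (l : X -> seq A) :
  PT (fun p : A * X => f p.2 p.1) -> PT l ->
  PT (fun x => flatten [seq f x a | a <- l x]).
Proof.
move=> pf pl.
apply: (@PT_ext _ _ (fun x => rev (foldl (fun acc a => catrev (f x a) acc) [::] (l x)))).
  by move=> x; rewrite foldl_flatten -/(rev _) revK.
apply: PT_rev.
have [c [d bf]] := PT_size pf.
(* An element is no larger than its list, so [b x] bounds every block. The 2 comes from the node of
   the pair and the successor in [pb]. *)
pose b x := c * (esize (l x) + esize x + 2) ^ d.
apply: (@PT_foldl _ _ _ l (fun=> [::]) (fun x acc a => catrev (f x a) acc)
  (fun x => esize (l x) * b x + 1)) => //.
- exact: PT_const.
- apply: PT_catrev; last by apply/PT_fst/PT_snd/PT_id.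
  apply: (@PT_comp _ _ _ _ (fun q : A * (seq B * X) => (q.1, q.2.2)) pf).
  by apply: PT_pair; [apply: PT_fst PT_id|apply/PT_snd/PT_snd/PT_id].
- rewrite /b; pb_auto.
move=> x l1 l2 lx; rewrite foldl_flatten.
have : esize (flatten [seq f x a | a <- l1]) <= size l1 * b x + 1.
  have : esize l1 <= esize (l x).
    by rewrite lx; have := esize_cat l1 l2; have := esize_gt0 l2; lia.
  elim: l1 {lx} => [|a l1 IH]; first by rewrite esize_nil.
  rewrite esize_cons => le /=; have := esize_cat (f x a) (flatten [seq f x a | a <- l1]).
  have : esize (f x a) <= b x.
    apply: leq_trans (bf (a, x)) _; rewrite leq_mul2l; apply/orP; right.
    case: (d) => // e; rewrite leq_exp2r // esize_pair.
    by have := esize_gt0 l1; lia.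
  by have := IH (ltac:(lia)); rewrite mulSn; lia.
have := esize_catrev (flatten [seq f x a | a <- l1]) [::]; rewrite esize_nil.
have : size l1 <= esize (l x).
  have := size_le_esize (l x); rewrite lx size_cat; lia.
move=> /leq_mul/(_ (leqnn (b x))); lia.
Qed.

End Flatmap.

Section MapFilter.
Variables (A B X : encType).

Lemma PT_map (f : X -> A -> B) (l : X -> seq A) :
  PT (fun p : A * X => f p.2 p.1) -> PT l -> PT (fun x => [seq f x a | a <- l x]).
Proof.
move=> pf pl; apply: (@PT_ext _ _ (fun x => flatten [seq [:: f x a] | a <- l x])).
  by move=> x; elim: (l x) => //= a s ->.
by apply: (PT_flatmap (f := fun x a => [:: f x a])) pl; apply: PT_cons pf (PT_const _).
Qed.

Lemma PT_filter (f : X -> A -> bool) (l : X -> seq A) :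
  PT (fun p : A * X => f p.2 p.1) -> PT l -> PT (fun x => [seq a <- l x | f x a]).
Proof.
move=> pf pl; apply: (@PT_ext _ _ (fun x =>
  flatten [seq (if f x a then [:: a] else [::]) | a <- l x])).
  by move=> x; elim: (l x) => //= a s ->; case: (f x a).
apply: (PT_flatmap (f := fun x a => if f x a then [:: a] else [::])) pl.
apply: PT_if => //; last exact: PT_const.
by apply: PT_cons (PT_const _); apply: PT_fst PT_id.
Qed.

Lemma PT_has (f : X -> A -> bool) (l : X -> seq A) :
  PT (fun p : A * X => f p.2 p.1) -> PT l -> PT (fun x => has (f x) (l x)).
Proof.
move=> pf pl; apply: (@PT_ext _ _ (fun x => ~~ nilp [seq a <- l x | f x a])).
  by move=> x; rewrite /nilp size_filter has_count lt0n.
by apply/PT_not/PT_nilp/PT_filter.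
Qed.

End MapFilter.

Ltac pt := try assumption; lazymatch goal with
  | |- @PT _ _ (fun x => x) => exact: PT_id
  | |- @PT _ _ fst => exact: PT_fst_
  | |- @PT _ _ snd => exact: PT_snd_
  | |- @PT _ _ (fun _ => ?b) => exact: PT_const
  | |- @PT _ _ (fun x => (@?f x, @?g x)) => apply: (PT_pair (f := f) (g := g)); pt
  | |- @PT _ _ (fun x => (@?f x).1) => apply: (PT_fst (f := f)); pt
  | |- @PT _ _ (fun x => (@?f x).2) => apply: (PT_snd (f := f)); pt
  | |- @PT _ _ (fun x => @?f x :: @?g x) => apply: (PT_cons (f := f) (g := g)); pt
  | |- @PT _ _ (fun x => @?f x ++ @?g x) => apply: (PT_cat (f := f) (g := g)); pt
  | |- @PT _ _ (fun x => rev (@?f x)) => apply: (PT_rev (f := f)); pt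
  | |- @PT _ _ (fun x => behead (@?f x)) => apply: (PT_behead (f := f)); pt
  | |- @PT _ _ (fun x => head ?a (@?f x)) => apply: (@PT_head _ _ _ f); pt
  | |- @PT _ _ (fun x => ~~ (@?f x)) => apply: (PT_not (b := f)); pt
  | |- @PT _ _ (fun x => (@?f x) && (@?g x)) => apply: (PT_and (a := f) (b := g)); pt
  | |- @PT _ _ (fun x => if _ then _ else _) => apply: PT_if; pt
  | |- _ => idtac
  end.

(** * Binary arithmetic *)

Notation num := (seq bool).

(** Least significant digit first. Zeros at the end are allowed, so a value has many numerals and
    costs are compared by [ble], not by equality. *)
Definition bval (l : num) : nat := foldr (fun (b : bool) n => b + n.*2) 0 l.

Definition badd_step (st : bool * (num * (num * num))) (_ : bool) :=
  let a := head false st.2.1 in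
  let b := head false st.2.2.1 in
  (if a then (if b then true else st.1) else (if b then st.1 else false),
   (behead st.2.1, (behead st.2.2.1,
     (if a then (if b then st.1 else ~~ st.1) else (if b then ~~ st.1 else st.1))
       :: st.2.2.2))).

(** The list folded over is only a clock with [(maxn (size x) (size y)).+1] ticks, the last of them
    for the carry; a sum is thus one digit longer than its longer summand. *)
Definition badd (x y : num) : num :=
  rev (foldl badd_step (false, (x, (y, [::])))
        (x ++ foldl (fun l _ => behead l) y x ++ [:: false])).2.2.2.

Lemma foldl_behead (T U : Type) (y : seq T) (x : seq U) :
  foldl (fun l _ => behead l) y x = drop (size x) y.
Proof.
elim: x y => [|a x IH] y /=; first by rewrite drop0.
by rewrite IH; case: y.
Qed.

Lemma badd_loop (l : num) n c x y out : size l = n.+1 -> size x <= n -> size y <= n ->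
  exists2 z, (foldl badd_step (c, (x, (y, out))) l).2.2.2 = catrev z out &
    bval z = c + bval x + bval y /\ size z = n.+1.
Proof.
elim: l n c x y out => [//|b l IH] [|n] c x y out /= [sl].
  (* At the last tick both numerals are used up and the digit written is the carry. *)
  case: l sl {IH} => // _; case: x => // _; case: y => // _ /=.
  by exists [:: c] => /=; last by rewrite doubleE; lia.
move=> sx sy; rewrite [badd_step (c, _) _]/badd_step /=.
set c' := if _ then _ else _; set d := if _ then _ else _.
have [|||z -> [zv zs]] := IH n c' (behead x) (behead y) (d :: out); rewrite ?size_behead; [lia..|].
exists (d :: z); rewrite //= zs zv; split=> //; rewrite {zv}/c' {c'}/d {d}.
by case: x {sx} => [|[] x]; case: y {sy} => [|[] y] /=; case: c => /=; lia.
Qed.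

Lemma badd_prop x y : bval (badd x y) = bval x + bval y /\ size (badd x y) = (maxn (size x) (size y)).+1.
Proof.
rewrite /badd foldl_behead.
have [|||z -> [zv zs]] := @badd_loop (x ++ drop (size x) y ++ [:: false]) (maxn (size x) (size y))
   false x y [::]; rewrite ?leq_maxl ?leq_maxr //.
  rewrite !size_cat size_drop /=; lia.
by rewrite -/(rev z) revK zv zs.
Qed.

Lemma bval_badd x y : bval (badd x y) = bval x + bval y.
Proof. by case: (badd_prop x y). Qed.

Lemma size_badd x y : size (badd x y) = (maxn (size x) (size y)).+1.
Proof. by case: (badd_prop x y). Qed.

Lemma size_num (x : num) : size x < esize x.
Proof. exact: size_le_esize. Qed.

Lemma esize_num (x : num) : esize x <= 4 * size x + 1.
Proof.
elim: x => [|b x IH]; first by rewrite esize_nil.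
rewrite esize_cons /=; have : esize b <= 3 by case: b.
  lia.
Qed.

Lemma PT_foldl_behead (A B X : encType) (f : X -> seq A) (g : X -> seq B) :
  PT f -> PT g -> PT (fun x => foldl (fun l _ => behead l) (g x) (f x)).
Proof.
move=> pf pg.
apply: (@PT_foldl _ _ _ f g (fun _ l _ => behead l) (fun x => esize (g x))) => //.
- by pt.
- exact: PT_size.
move=> x l1 l2 _; rewrite foldl_behead.
have := esize_cat (take (size l1) (g x)) (drop (size l1) (g x)); rewrite cat_take_drop.
by have := esize_gt0 (take (size l1) (g x)); lia.
Qed.

Lemma PT_badd (X : encType) (f g : X -> num) : PT f -> PT g -> PT (fun x => badd (f x) (g x)).
Proof.
apply: PT_app2; rewrite /badd; apply: PT_rev; do 3 apply: PT_snd.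
apply: (@PT_foldl _ _ _ (fun p => p.1 ++ foldl (fun l _ => behead l) p.2 p.1 ++ [:: false])
   (fun p => (false, (p.1, (p.2, [::])))) (fun _ => badd_step)
   (fun p => 30 + 10 * esize p)).
- pt.
  by apply: PT_foldl_behead; pt.
- by pt.
- by rewrite /badd_step /=; pt.
- pb_auto.
move=> [x y] l1 l2 /=; rewrite foldl_behead => lx.
have : @size bool l1 <= @size bool x + @size bool y + 1.
  by have := congr1 (@size bool) lx; rewrite !size_cat size_drop /=; lia.
suff : forall c z t o, esize (foldl badd_step (c, (z, (t, o))) l1) <=
  6 + esize z + esize t + esize o + 4 * @size bool l1.
  move=> /(_ false x y [::]); rewrite esize_pair esize_nil.
  by have := size_num x; have := size_num y; lia.
elim: l1 {lx} => [|b l1 IH] c z t o.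
  rewrite /= !esize_pair; have : esize c <= 3 by case: c.
  lia.
rewrite [foldl _ _ _]/= [badd_step (c, _) _]/badd_step /=; set c' := if _ then _ else _; set d := if _ then _ else _.
apply: leq_trans (IH _ _ _ _) _; rewrite esize_cons.
have : esize d <= 3 by case: d.
have bh (u : num) : esize (behead u) <= esize u by case: u => [|a u] //=; rewrite esize_cons; lia.
by have := bh z; have := bh t => /=; lia.
Qed.

(** Horner's scheme from the most significant digit of [y]; putting [false] in front doubles the
    accumulator. *)
Definition bmul (x y : num) : num :=
  foldl (fun acc b => if b then badd (false :: acc) x else false :: acc) [::] (rev y).

Lemma bval_bmul x y : bval (bmul x y) = bval x * bval y.
Proof.
rewrite /bmul; elim: y => [|b y IH]; first by rewrite muln0.
rewrite rev_cons foldl_rcons; case: b; rewrite ?bval_badd /= IH; lia.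
Qed.

Lemma bmul_loop x l acc :
  size (foldl (fun acc b => if b then badd (false :: acc) x else false :: acc) acc l)
  <= maxn (size x) (size acc) + 2 * size l.
Proof.
elim: l acc => [|b l IH] acc /=; first by lia.
apply: leq_trans (IH _) _; case: b; rewrite ?size_badd /=; lia.
Qed.

Lemma size_bmul x y : size (bmul x y) <= size x + 2 * size y.
Proof. by apply: leq_trans (bmul_loop _ _ _) _; rewrite size_rev /=; lia. Qed.

Lemma PT_bmul (X : encType) (f g : X -> num) : PT f -> PT g -> PT (fun x => bmul (f x) (g x)).
Proof.
apply: PT_app2; rewrite /bmul.
apply: (@PT_foldl _ _ _ (fun p => rev p.2) (fun _ => [::])
   (fun p acc b => if b then badd (false :: acc) p.1 else false :: acc)
   (fun p => 10 + 10 * esize p)).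
- by pt.
- by pt.
- by pt; apply: PT_badd; pt.
- pb_auto.
move=> [x y] l1 l2 /= ly; have sl : @size bool l1 <= @size bool y.
  by rewrite -(size_rev y) ly size_cat leq_addr.
apply: leq_trans (esize_num _) _; have := bmul_loop x l1 [::]; rewrite esize_pair /=.
by have := size_num x; have := size_num y; lia.
Qed.

(** The flag compares the digits read so far; a later digit is more significant, so it overrides the
    flag unless the two digits agree. *)
Definition ble_step (st : bool * (num * num)) (_ : bool) :=
  let a := head false st.2.1 in
  let b := head false st.2.2 in
  (if a then (if b then st.1 else false) else (if b then true else st.1),
   (behead st.2.1, behead st.2.2)).

Definition ble (x y : num) : bool := (foldl ble_step (true, (x, y)) (x ++ y)).1.

Lemma bleE x y : ble x y = (bval x <= bval y).
Proof.
rewrite /ble; suff H r l : size x <= size l -> size y <= size l ->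
    (foldl ble_step (r, (x, y)) l).1 = (bval x < bval y) || (bval x == bval y) && r.
  by rewrite H ?size_cat ?leq_addr ?leq_addl //; lia.
elim: l r x y => [|b l IH] r x y /=.
  by case: x => // _; case: y => // _; rewrite eqxx.
move=> sx sy; rewrite IH /=; try by rewrite /= size_behead; lia.
by case: x {sx} => [|[] x]; case: y {sy} => [|[] y] /=; case: r; lia.
Qed.

Lemma PT_ble (X : encType) (f g : X -> num) : PT f -> PT g -> PT (fun x => ble (f x) (g x)).
Proof.
apply: PT_app2; rewrite /ble; apply: PT_fst.
apply: (@PT_foldl _ _ _ (fun p => p.1 ++ p.2)
   (fun p => (true, (p.1, p.2))) (fun _ => ble_step)
   (fun p => 10 + 10 * esize p)).
- by pt.
- by pt.
- by rewrite /ble_step /=; pt.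
- pb_auto.
move=> [x y] l1 l2 _; suff : forall c z t, esize (foldl ble_step (c, (z, t)) l1) <=
  6 + esize z + esize t.
  by move=> /(_ true x y); rewrite /= esize_pair; lia.
elim: l1 => [|b l1 IH] c z t.
  rewrite /= !esize_pair; have : esize c <= 3 by case: c.
  lia.
apply: leq_trans (IH _ _ _) _.
have bh (u : num) : esize (behead u) <= esize u by case: u => [|a u] //=; rewrite esize_cons; lia.
by have := bh z; have := bh t => /=; lia.
Qed.

(** * The dynamic program *)

(* A nonnegative rational is an unreduced pair (numerator, denominator). *)
Notation frac := (num * num)%type.
Notation arc := (tree * (tree * (bool * frac)))%type.

(* An arc is identified by the suffix of the input arc list that starts with it;
   this keeps parallel arcs apart. *)
Notation item := (seq arc).
Notation entry := (seq tree * (frac * seq item))%type.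

(** Nothing is cancelled, so no gcd has to be computed. By [size_cadd] the growth per addition
    depends on the digits of [w] alone, which keeps sums along the arc list polynomial. *)
Definition cadd (c w : frac) : frac :=
  (badd (bmul c.1 w.2) (bmul c.2 w.1), bmul c.2 w.2).
Definition cle (c c' : frac) : bool := ble (bmul c.1 c'.2) (bmul c'.1 c.2).

Definition arc0 : arc := (Leaf, (Leaf, (false, ([::], [::])))).
Definition itail (x : item) : tree := (head arc0 x).1.
Definition ihead (x : item) : tree := (head arc0 x).2.1.
Definition ivul (x : item) : bool := (head arc0 x).2.2.1.
Definition iwgt (x : item) : frac := (head arc0 x).2.2.2.

Definition items (s : seq arc) : seq item :=
  rev (foldl (fun st _ => (behead st.1, st.1 :: st.2)) (s, [::]) s).2.

Definition ready (R : seq item) (x : item) : bool :=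
  ~~ has (fun y => ihead y == itail x) R.

(** Kahn's algorithm in rounds, with [s] itself as the clock: in an acyclic graph every round with
    items left outputs at least one, so [size s] rounds suffice. *)
Definition tsort (s : seq item) : seq item :=
  (foldl (fun st _ => ([seq x <- st.1 | ~~ ready st.1 x], st.2 ++ [seq x <- st.1 | ready st.1 x]))
    (s, [::]) s).2.

(** Equal token positions have equal continuations, so a cheapest entry per key is enough. *)
Definition insert (T : seq entry) (e : entry) : seq entry :=
  if has (fun e' => (e'.1 == e.1) && cle e'.2.1 e.2.1) T then T
  else e :: [seq e' <- T | e'.1 != e.1].

Definition prune : seq entry -> seq entry := foldl insert [::].

(* A partial move: whether some token has moved, and the tokens treated so far
   in reverse order. *)
Definition mext (u v : tree) (vul : bool) (x : tree) (p : bool * seq tree) :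
    seq (bool * seq tree) :=
  (p.1, x :: p.2) ::
  (if (x == u) && ~~ (vul && p.1) then [:: (true, v :: p.2)] else [::]).

Definition mstep (u v : tree) (vul : bool) (st : seq tree * seq (bool * seq tree)) :=
  (behead st.1, flatten [seq mext u v vul (head Leaf st.1) p | p <- st.2]).

(** The number of iterations is the fixed number of tokens; the program is unrolled and the list of
    at most [2 ^ n] partial moves has constant length. *)
Definition moves n (x : item) (key : seq tree) : seq (bool * seq tree) :=
  (iter n (mstep (itail x) (ihead x) (ivul x)) (key, [:: (false, [::])])).2.

Definition expand n (x : item) (e : entry) : seq entry :=
  [seq (p.2, (cadd e.2.1 (iwgt x), x :: e.2.2)) | p <- moves n x e.1].

Definition tstep n (T : seq entry) (x : item) : seq entry :=
  prune (T ++ flatten [seq expand n x e | e <- T]).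

(** At the start all tokens are at [s], the cost is 0/1 and no arc is bought. *)
Definition dp n (s : tree) (l : seq item) : seq entry :=
  foldl (tstep n) [:: (nseq n s, (([::], [:: true]), [::]))] l.

Definition finals n (t : tree) (T : seq entry) : seq entry :=
  [seq e <- T | e.1 == nseq n t].

Definition entry0 : entry := ([::], (([::], [::]), [::])).

Definition solve n (i : seq tree * (tree * (tree * seq arc))) : option (seq bool) :=
  let T := finals n i.2.2.1 (dp n i.2.1 (tsort (items i.2.2.2))) in
  if nilp T then None
  else Some [seq has (fun y => y == x) (head entry0 T).2.2 | x <- items i.2.2.2].

(** * Polynomial time of the operations on the table *)

Lemma PT_cadd (X : encType) (f g : X -> frac) : PT f -> PT g -> PT (fun x => cadd (f x) (g x)).
Proof.
move=> pf pg; apply: PT_pair; [apply: PT_badd|]; apply: PT_bmul; by pt.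
Qed.

Lemma PT_cle (X : encType) (f g : X -> frac) : PT f -> PT g -> PT (fun x => cle (f x) (g x)).
Proof. by move=> pf pg; apply: PT_ble; apply: PT_bmul; pt. Qed.

Lemma PT_itail (X : encType) (f : X -> item) : PT f -> PT (fun x => itail (f x)).
Proof. by move=> pf; rewrite /itail; pt. Qed.

Lemma PT_ihead (X : encType) (f : X -> item) : PT f -> PT (fun x => ihead (f x)).
Proof. by move=> pf; rewrite /ihead; pt. Qed.

Lemma PT_ivul (X : encType) (f : X -> item) : PT f -> PT (fun x => ivul (f x)).
Proof. by move=> pf; rewrite /ivul; pt. Qed.

Lemma PT_iwgt (X : encType) (f : X -> item) : PT f -> PT (fun x => iwgt (f x)).
Proof. by move=> pf; rewrite /iwgt; pt. Qed.

Lemma PT_eq_tree (X : encType) (f g : X -> tree) : PT f -> PT g -> PT (fun x => f x == g x).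
Proof. exact: PT_eq. Qed.

Lemma eq_enc (T : eqType) (e : T -> tree) (a b : T) : injective e -> (a == b) = (e a == e b).
Proof. by move=> ie; apply/eqP/eqP => [->|/ie]. Qed.

Lemma PT_eq_key (X : encType) (f g : X -> seq tree) : PT f -> PT g -> PT (fun x => f x == g x).
Proof.
by apply: PT_eq => x; apply: (@eq_enc _ (@enc (seq_encType tree_encType))); apply: enc_seq_inj.
Qed.

Lemma PT_eq_item (X : encType) (f g : X -> item) : PT f -> PT g -> PT (fun x => f x == g x).
Proof.
apply: PT_eq => x; apply: (@eq_enc _ (@enc _ : item -> tree)); apply: enc_seq_inj.
by do !apply: enc_prod_inj => //; try exact: enc_bool_inj; apply: enc_seq_inj; apply: enc_bool_inj.
Qed.


Ltac ptc := pt; lazymatch goal with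
  | |- @PT _ _ (fun x => itail (@?f x)) => apply: (PT_itail (f := f)); ptc
  | |- @PT _ _ (fun x => ihead (@?f x)) => apply: (PT_ihead (f := f)); ptc
  | |- @PT _ _ (fun x => ivul (@?f x)) => apply: (PT_ivul (f := f)); ptc
  | |- @PT _ _ (fun x => iwgt (@?f x)) => apply: (PT_iwgt (f := f)); ptc
  | |- @PT _ _ (fun x => cadd (@?f x) (@?g x)) => apply: (PT_cadd (f := f) (g := g)); ptc
  | |- @PT _ _ (fun x => cle (@?f x) (@?g x)) => apply: (PT_cle (f := f) (g := g)); ptc
  | |- _ => idtac
  end.

Lemma PT_ready (X : encType) (R : X -> seq item) (f : X -> item) :
  PT R -> PT f -> PT (fun x => ready (R x) (f x)).
Proof.
apply: PT_app2; apply: PT_not.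
apply: (PT_has (f := fun (p : seq item * item) y => ihead y == itail p.2)); last by pt.
by apply: PT_eq_tree; ptc.
Qed.

Section Esize.
Variable A : encType.

Lemma esize_filterC (p : pred A) (s : seq A) :
  esize [seq x <- s | p x] + esize [seq x <- s | ~~ p x] = (esize s).+1.
Proof.
elim: s => [|x s IH] //=.
by case: (p x) => /=; rewrite !esize_cons; lia.
Qed.

Lemma esize_filter (p : pred A) (s : seq A) : esize [seq x <- s | p x] <= esize s.
Proof. by have := esize_filterC p s; have := esize_gt0 [seq x <- s | ~~ p x]; lia. Qed.

End Esize.

(** A round only redistributes items between the two lists, so the encoded size of the state never
    changes. *)
Lemma PT_tsort (X : encType) (f : X -> seq item) : PT f -> PT (fun x => tsort (f x)).
Proof.
apply: PT_comp; apply: PT_snd.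
apply: (@PT_foldl _ _ _ id (fun s => (s, [::])) (fun _ st _ =>
   ([seq x <- st.1 | ~~ ready st.1 x], st.2 ++ [seq x <- st.1 | ready st.1 x]))
   (fun s => esize s + 5)).
- exact: PT_id.
- by pt.
- pt.
    apply: (PT_filter (f := fun (p : item * ((seq item * seq item) * seq item)) x =>
      ~~ ready p.2.1.1 x)); last by pt.
    by apply: PT_not; apply: PT_ready; pt.
  apply: (PT_filter (f := fun (p : item * ((seq item * seq item) * seq item)) x =>
      ready p.2.1.1 x)); last by pt.
  by apply: PT_ready; pt.
- pb_auto.
move=> s l1 l2 _ /=.
suff : forall R out, esize (foldl (fun st _ => ([seq x <- st.1 | ~~ ready st.1 x],
    st.2 ++ [seq x <- st.1 | ready st.1 x])) (R, out) l1) = esize (R, out).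
  by move=> ->; rewrite esize_pair esize_nil; lia.
elim: l1 => //= _ l1 IH R out; rewrite IH !esize_pair.
have : esize [seq x <- R | ready R x] + esize [seq x <- R | ~~ ready R x] = (esize R).+1.
  exact: esize_filterC.
by have := esize_cat out [seq x <- R | ready R x] => /=; lia.
Qed.

(** Every suffix is no larger than the list, so all of them together have quadratic size. *)
Lemma PT_items (X : encType) (f : X -> seq arc) : PT f -> PT (fun x => items (f x)).
Proof.
apply: PT_comp; apply: PT_rev; apply: PT_snd.
apply: (@PT_foldl _ _ _ id (fun s => (s, [::])) (fun _ st _ => (behead st.1, st.1 :: st.2))
   (fun s => esize s + 1 + (esize s * (esize s).+1 + 1))).
- exact: PT_id.
- by pt.
- by pt.
- pb_auto.
move=> s l1 l2 /= sl.
suff : forall (c : seq arc) (out : seq item), esize c <= esize s ->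
   esize (foldl (fun st _ => (behead st.1, st.1 :: st.2)) (c, out) l1)
   <= esize s + 1 + (size l1 * (esize s).+1 + esize out).
  move=> /(_ s [::] (leqnn _)) /leq_trans -> //.
  rewrite leq_add2l esize_nil leq_add2r leq_mul2r /=.
  have : @size arc l1 <= @size arc s by rewrite sl size_cat leq_addr.
  by have := size_le_esize s => /=; lia.
elim: l1 {sl} => [|a l1 IH] c out cs.
  by rewrite /= esize_pair mul0n; lia.
apply: leq_trans (IH _ _ _) _ => /=.
  by case: c cs => [|b c] //=; rewrite esize_cons; lia.
by rewrite esize_cons mulSn; lia.
Qed.

Lemma PT_insert (X : encType) (f : X -> seq entry) (g : X -> entry) :
  PT f -> PT g -> PT (fun x => insert (f x) (g x)).
Proof.
apply: PT_app2; apply: PT_if; first 1 last.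
- by pt.
- pt; apply: (PT_filter (f := fun (p : seq entry * entry) (e : entry) => e.1 != p.2.1)); last by pt.
  by apply: PT_not; apply: PT_eq_key; pt.
apply: (PT_has (f := fun (p : seq entry * entry) (e : entry) => (e.1 == p.2.1) && cle e.2.1 p.2.2.1)); last by pt.
by apply: PT_and; [apply: PT_eq_key; pt|ptc].
Qed.

Lemma esize_insert T e : esize (insert T e) <= (esize T + esize e).+1.
Proof.
rewrite /insert; case: ifP => _; first by rewrite leqW ?leq_addr.
by rewrite esize_cons; have := esize_filter (fun e' : entry => e'.1 != e.1) T => /=; lia.
Qed.

Lemma esize_foldl_insert T l : (esize (foldl insert T l)).+1 <= esize T + esize l.
Proof.
elim: l T => [|e l IH] T; first by rewrite esize_nil addn1.
by apply: leq_trans (IH _) _; rewrite esize_cons; have := esize_insert T e => /=; lia.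
Qed.

Lemma PT_prune (X : encType) (f : X -> seq entry) : PT f -> PT (fun x => prune (f x)).
Proof.
apply: PT_comp; rewrite /prune.
apply: (@PT_foldl _ _ _ id (fun=> [::]) (fun _ => insert) (fun l => esize l)).
- exact: PT_id.
- by pt.
- by apply: PT_insert; pt.
- pb_auto.
move=> l l1 l2 /= ->; have := esize_foldl_insert [::] l1; rewrite esize_nil.
by have := esize_cat l1 l2; have := esize_gt0 l2 => /=; lia.
Qed.

Lemma PT_moves n (X : encType) (f : X -> item) (g : X -> seq tree) :
  PT f -> PT g -> PT (fun x => moves n (f x) (g x)).
Proof.
(* The arc is carried along in the state, since [PT_iter] iterates a function of the state alone. *)
apply: PT_app2; apply: (@PT_ext _ _ (fun p => (iter n (fun q : item * (seq tree * seq (bool * seq tree)) =>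
   (q.1, mstep (itail q.1) (ihead q.1) (ivul q.1) q.2)) (p.1, (p.2, [:: (false, [::])]))).2.2)).
  move=> [x key]; rewrite /moves; move: [:: _] => st /=.
  by rewrite (_ : iter n _ _ = (x, iter n (mstep (itail x) (ihead x) (ivul x)) (key, st))) //;
    elim: n => //= n ->.
apply: PT_snd; apply: PT_snd; apply: PT_iter; last by pt.
rewrite /mstep; pt.
apply: (PT_flatmap (f := fun (q : item * (seq tree * seq (bool * seq tree))) p =>
   mext (itail q.1) (ihead q.1) (ivul q.1) (head Leaf q.2.1) p)); last by pt.
rewrite /mext; ptc.
by apply: PT_eq_tree; ptc.
Qed.

Lemma PT_expand n (X : encType) (f : X -> item) (g : X -> entry) :
  PT f -> PT g -> PT (fun x => expand n (f x) (g x)).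
Proof.
apply: PT_app2; apply: (PT_map (f := fun (q : item * entry) (p : bool * seq tree) =>
  (p.2, (cadd q.2.2.1 (iwgt q.1), q.1 :: q.2.2.2)))); first by ptc.
by apply: PT_moves; pt.
Qed.

Lemma PT_tstep n (X : encType) (f : X -> seq entry) (g : X -> item) :
  PT f -> PT g -> PT (fun x => tstep n (f x) (g x)).
Proof.
apply: PT_app2; apply: PT_prune; pt.
apply: (PT_flatmap (f := fun (q : seq entry * item) e => expand n q.2 e)); last by pt.
by apply: PT_expand; pt.
Qed.

(** * Moving tokens *)

Definition mparts (u v : tree) (vul : bool) (key : seq tree) (parts : seq (bool * seq tree)) :=
  foldl (fun ps x => flatten [seq mext u v vul x p | p <- ps]) parts key.

Lemma iter_mstep u v vul key parts :
  iter (size key) (mstep u v vul) (key, parts) = ([::], mparts u v vul key parts).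
Proof.
elim: key parts => //= x key IH parts; rewrite -iterS iterSr /mstep /=.
by rewrite IH.
Qed.

Lemma movesE n x key : size key = n ->
  moves n x key = mparts (itail x) (ihead x) (ivul x) key [:: (false, [::])].
Proof. by move=> <-; rewrite /moves iter_mstep. Qed.

(** Positions are compared as multisets, because treating the tokens one by one reverses their
    order. Counting under every predicate serves both single vertices and cuts, and the form with
    two sums avoids subtraction. *)
Definition moved (u v : tree) j (key key' : seq tree) : Prop :=
  forall P : pred tree, count P key' + j * P u = count P key + j * P v.

(** The flag counts as one earlier move, so on a vulnerable arc it and the [j] later moves together
    stay at most 1. *)
Lemma mparts_sound (u v : tree) (vul : bool) key parts (p' : bool * seq tree) : p' \in mparts u v vul key parts ->
  exists p j, [/\ p \in parts, j <= count_mem u key, (vul -> p.1 + j <= 1)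
    & forall P : pred tree, count P p'.2 + j * P u = count P p.2 + count P key + j * P v].
Proof.
elim: key parts => [|x key IH] parts /=.
  by move=> pp; exists p', 0; split=> //= [_|P]; [case: p'.1|lia].
case/IH => q [j [/flattenP[_ /mapP[p pin ->]] qin jc vj cP]].
move: qin; rewrite /mext inE => /predU1P[qE|].
  exists p, j; split=> //; [exact: leq_trans jc (leq_addl _ _)|by rewrite qE in vj|].
  by move=> P; have := cP P; rewrite qE /=; lia.
case: ifP => // /andP[/eqP xu nv]; rewrite inE => /eqP qE.
exists p, j.+1; split=> //.
- by rewrite xu eqxx add1n ltnS.
- move=> vt; have := vj vt; rewrite qE vt /= in nv *; case: p.1 nv => //=; lia.
by move=> P; have := cP P; rewrite qE xu /=; lia.
Qed.

(** Tokens are moved as late as possible: the current one stays if the rest of [key] still has [j]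
    tokens at [u], and otherwise it stands at [u] and has to move. *)
Lemma mparts_complete (u v : tree) (vul : bool) key parts (p : bool * seq tree) j :
  p \in parts -> j <= count_mem u key -> (vul -> p.1 + j <= 1) ->
  exists2 p', p' \in mparts u v vul key parts
    & forall P : pred tree, count P p'.2 + j * P u = count P p.2 + count P key + j * P v.
Proof.
have cE x s : count_mem u (x :: s) = (x == u) + count_mem u s by [].
elim: key parts p j => [|x key IH] parts p j pin; last rewrite cE.
  by rewrite /= leqn0 => /eqP-> _; exists p => // P; lia.
move=> jc vj; have [jc'|jc'] := leqP j (count_mem u key).
  have [|//|//|p' p'in cP] := IH (flatten [seq mext u v vul x q | q <- parts]) (p.1, x :: p.2) j.
    by apply/flattenP; exists (mext u v vul x p); [apply: map_f|rewrite inE eqxx].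
  by exists p' => // P; have := cP P => /=; lia.
case: eqP jc => [xu|_] jc; last by move: jc jc'; rewrite add0n leqNgt => /negbTE->.
case: j vj jc jc' => // j vj jc jc'.
have [| | |p' p'in cP] := IH (flatten [seq mext u v vul x q | q <- parts]) (true, v :: p.2) j.
- apply/flattenP; exists (mext u v vul x p); first exact: map_f.
  rewrite /mext xu eqxx /=; case: ifP => [|/negbFE/andP[vt p1]]; first by rewrite !inE eqxx orbT.
  by have := vj vt; rewrite p1.
- by move: jc; rewrite add1n ltnS.
- by move=> /vj /=; case: p.1 => /=; lia.
by exists p' => // P; have := cP P; rewrite xu /=; lia.
Qed.

Lemma moves_sound n x key p : size key = n -> p \in moves n x key ->
  exists2 j, j <= count_mem (itail x) key /\ (ivul x -> j <= 1)
    & moved (itail x) (ihead x) j key p.2.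
Proof.
move=> kn; rewrite movesE // => /mparts_sound[q [j [+ jc vj cP]]].
rewrite inE => /eqP qE; exists j; first by rewrite qE in vj.
by move=> P; have := cP P; rewrite qE.
Qed.

Lemma moves_complete n x key j : size key = n -> j <= count_mem (itail x) key ->
  (ivul x -> j <= 1) ->
  exists2 p, p \in moves n x key & moved (itail x) (ihead x) j key p.2.
Proof.
move=> kn jc vj; rewrite movesE //.
have [|//|//|p pin cP] := @mparts_complete (itail x) (ihead x) (ivul x) key [:: (false, [::])]
  (false, [::]) j; first by rewrite inE.
by exists p.
Qed.

Lemma moved_size u v j key key' : moved u v j key key' -> size key' = size key.
Proof. by move=> /(_ predT); rewrite !count_predT => /addIn. Qed.

(** * Size of the table *)

Lemma insert_sub T e e' : e' \in insert T e -> e' \in e :: T.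
Proof.
rewrite /insert; case: ifP => _; first by rewrite inE orbC => ->.
by rewrite !inE mem_filter => /orP[->//|/andP[_ ->]]; rewrite orbT.
Qed.

Lemma prune_sub l e : e \in prune l -> e \in l.
Proof.
suff gen T : e \in foldl insert T l -> e \in T ++ l by apply: gen.
elim: l T => [|a l IH] T /=; first by rewrite cats0.
move=> /IH; rewrite !mem_cat inE => /orP[/insert_sub|->]; rewrite ?orbT //.
by rewrite inE => /orP[] ->; rewrite ?orbT.
Qed.

Lemma insert_uniq T e : uniq [seq x.1 | x <- T] -> uniq [seq x.1 | x <- insert T e].
Proof.
rewrite /insert => uT; case: ifP => //= _; apply/andP; split.
  by apply/mapP => -[x]; rewrite mem_filter => /andP[/eqP + _] => xe ex; apply: xe.
by rewrite -(filter_map _ (fun k => k != e.1)) filter_uniq.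
Qed.

Lemma prune_uniq l : uniq [seq x.1 | x <- prune l].
Proof.
rewrite /prune; have : uniq [seq x.1 | x <- ([::] : seq entry)] by [].
by elim: l [::] => //= a l IH T uT; apply: IH; apply: insert_uniq.
Qed.

Fixpoint words (T : Type) (s : seq T) n : seq (seq T) :=
  if n is n'.+1 then [seq a :: w | a <- s, w <- words s n'] else [:: [::]].

Lemma size_words (T : Type) (s : seq T) n : size (words s n) = size s ^ n.
Proof. by elim: n => //= n IH; rewrite size_allpairs IH expnS. Qed.

Lemma mem_words (T : eqType) (s : seq T) n w :
  (w \in words s n) = (size w == n) && all (mem s) w.
Proof.
elim: n w => [|n IH] [|a w] //=.
  by apply/allpairsP => -[[b v] [_ _]].
rewrite eqSS; apply/allpairsP/and3P => [[[b v] /= [bs vw [-> ->]]]|[wn as_ aw]].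
  by move: vw; rewrite IH => /andP[].
by exists (a, w); split=> //=; rewrite IH wn.
Qed.

Lemma size_cadd c w : maxn (size (cadd c w).1) (size (cadd c w).2)
  <= maxn (size c.1) (size c.2) + 2 * size w.1 + 2 * size w.2 + 1.
Proof.
rewrite /cadd /= size_badd.
have := size_bmul c.1 w.2; have := size_bmul c.2 w.1; have := size_bmul c.2 w.2; lia.
Qed.

Lemma size_iwgt (x : item) : size (iwgt x).1 + size (iwgt x).2 <= esize x.
Proof.
rewrite /iwgt; case: x => [|[u [v [b [p q]]]] x] //=.
rewrite esize_cons !esize_pair; have := size_num p; have := size_num q => /=; lia.
Qed.

Section TableSize.
Variables (n : nat) (s : tree) (l : seq item).

(** A token stands at the source or at the head of an arc it has crossed, so keys are words over
    [size l + 1] letters. *)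
Let alphabet := s :: [seq ihead x | x <- l].

Definition entry_ok (l1 : seq item) (e : entry) : Prop :=
  [/\ e.1 \in words alphabet n,
      maxn (size e.2.1.1) (size e.2.1.2) <= 3 * esize l1
    & esize e.2.2 <= esize l1].

(** One addition lengthens a cost by at most [2 * esize x + 1] digits, while the size of the prefix
    grows by [esize x + 1]; the factor 3 in [entry_ok] covers this. *)
Lemma dp_ok l1 l2 : l = l1 ++ l2 ->
  uniq [seq e.1 | e <- dp n s l1] /\ forall e, e \in dp n s l1 -> entry_ok l1 e.
Proof.
elim/last_ind: l1 l2 => [|l1 x IH] l2 lE.
  split=> // e; rewrite inE => /eqP->; split=> //=.
  by rewrite mem_words size_nseq eqxx all_nseq /= inE eqxx orbT.
rewrite cat_rcons in lE; have [_ IHe] := IH _ lE.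
rewrite /dp foldl_rcons -/(dp n s l1); split; first exact: prune_uniq.
have esz : esize (rcons l1 x) = (esize l1 + esize x).+1.
  by rewrite -cats1; have := esize_cat l1 [:: x]; rewrite esize_cons esize_nil => /=; lia.
move=> e /prune_sub; rewrite mem_cat => /orP[/IHe[ew es ec]|].
  by split=> //; rewrite esz; lia.
case/flattenP => _ /mapP[e0 /IHe[ew es ec] ->] /mapP[p pm ->]; split=> /=.
- move: ew; rewrite !mem_words => /andP[/eqP sn ea].
  have [j _ mv] := moves_sound sn pm; rewrite (moved_size mv) sn eqxx /=.
  (* Tokens off the alphabet are counted: there were none before, and the head where tokens arrive
     belongs to the alphabet. *)
  have c0 : count (predC (mem alphabet)) e0.1 = 0.
    by apply/eqP; rewrite eqn0Ngt -has_count has_predC ea.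
  have nx : predC (mem alphabet) (ihead x) = false.
    by rewrite /= inE lE map_cat mem_cat /= inE eqxx !orbT.
  rewrite -[all _ _]negbK -has_predC has_count -eqn0Ngt.
  have := mv (predC (mem alphabet)); rewrite c0 nx muln0.
  by move=> /eqP; rewrite addn_eq0 => /andP[].
- apply: leq_trans (size_cadd _ _) _; rewrite esz; have := size_iwgt x; lia.
- by rewrite esize_cons esz => /=; lia.
Qed.

End TableSize.

Lemma esize_mem (l : seq item) x : x \in l -> esize x < esize l.
Proof.
elim: l => //= y l IH; rewrite inE esize_cons => /predU1P[->|/IH]; lia.
Qed.

Lemma esize_ihead x : esize (ihead x) <= esize x.
Proof.
by case: x => [|[u [v [b w]]] x] //; rewrite /ihead /= esize_cons !esize_pair; lia.
Qed.

(** Keys are pairwise distinct words of length [n], so the table has at most [(esize p).+1 ^ n]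
    entries, a polynomial number because [n] is fixed. *)
Lemma PT_dp n (X : encType) (f : X -> tree) (g : X -> seq item) :
  PT f -> PT g -> PT (fun x => dp n (f x) (g x)).
Proof.
apply: PT_app2; rewrite /dp.
(* The first summand covers the key; the others cover two numerals of size at most
   [12 * esize l + 1] each and the list of bought arcs. *)
pose b (p : tree * seq item) := n * (esize p).+1 + 30 * esize p + 30.
apply: (@PT_foldl _ _ _ snd (fun p => [:: (nseq n p.1, (([::], [:: true]), [::]))])
  (fun _ => tstep n) (fun p => (esize p).+1 ^ n * (b p).+1 + 1)).
- by pt.
- by pt; apply: PT_nseq; pt.
- by apply: PT_tstep; pt.
- rewrite /b; pb_auto.
move=> [s l] l1 l2 /= lE; rewrite -/(dp n s l1).
have [uT okT] := @dp_ok n s l l1 l2 lE.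
have sA : size (s :: [seq ihead x | x <- l]) <= (esize (s, l)).+1.
  rewrite /= size_map esize_pair; have : @size item l < esize l by apply: size_le_esize.
  by lia.
apply: esize_seq_le.
  apply/allP => e /okT[ew es ec]; move: ew; rewrite mem_words => /andP[/eqP sn /allP ea].
  have l1l : esize l1 <= esize l.
    by rewrite lE; have := esize_cat l1 l2; have := esize_gt0 l2 => /=; lia.
  have : esize e.1 <= n * (esize (s, l)).+1 + 1.
    apply: esize_seq_le; last by rewrite sn.
    apply/allP => a /ea /=; rewrite inE esize_pair => /predU1P[->|/mapP[x /esize_mem xl ->]].
      by lia.
    by have := esize_ihead x; lia.
  case: e es ec {sn ea} => [key [[p q] ch]] /= es ec; rewrite /b !esize_pair.
  by have := esize_num p; have := esize_num q => /=; lia.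
rewrite -(size_map fst); apply: (@leq_trans (size (words (s :: [seq ihead x | x <- l]) n))).
  by apply: uniq_leq_size => // k /mapP[e /okT[ew _ _] ->].
rewrite size_words; case: (n) => // n'; rewrite leq_exp2r //.
Qed.

Lemma PT_solve n : PT (solve n).
Proof.
pose I := (seq tree * (tree * (tree * seq arc)))%type.
pose T (i : I) := finals n i.2.2.1 (dp n i.2.1 (tsort (items i.2.2.2))).
have pit : PT (fun i : I => items i.2.2.2) by apply: PT_items; pt.
have pT : PT T.
  apply: (PT_filter (f := fun (i : I) (e : entry) => e.1 == nseq n i.2.2.1)).
    by apply: PT_eq_key; pt; apply: PT_nseq; pt.
  by apply: PT_dp; [pt|apply: PT_tsort].
rewrite /solve; apply: PT_if; [exact: PT_nilp|by pt|apply: PT_some].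
apply: (PT_map (f := fun i (x : item) => has (fun y => y == x) (head entry0 (T i)).2.2)) pit.
apply: (PT_has (f := fun (p : item * I) (y : item) => y == p.1)).
  by apply: PT_eq_item; pt.
pt; apply: (@PT_comp _ _ _ _ (fun p : item * I => p.2) pT); by pt.
Qed.

(** * Integral flows *)

Section Flow.
Variables (V A : finType) (tl hd : A -> V) (cap : A -> nat) (s t : V).
Implicit Types (f g : A -> nat) (u v : V).
Local Open Scope ring_scope.

(** With this sign [net] is outflow minus inflow, and a loop contributes 0. *)
Definition incidence (a : A) v : int := (tl a == v)%:Z - (hd a == v)%:Z.

Definition net f v : int := \sum_a (f a)%:Z * incidence a v.

Definition is_flow (N : nat) f : Prop :=
  (forall a, (f a <= cap a)%N) /\ forall v, net f v = N%:Z * ((v == s)%:Z - (v == t)%:Z).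

Definition residual f : rel V := fun u v =>
  [exists a, [&& tl a == u, hd a == v & (f a < cap a)%N]] ||
  [exists a, [&& hd a == u, tl a == v & (0 < f a)%N]].

Definition set_arc f a n : A -> nat := fun b => if b == a then n else f b.

Lemma net_set_arc f a n v :
  net (set_arc f a n) v = net f v + (n%:Z - (f a)%:Z) * incidence a v.
Proof.
rewrite /net (bigD1 a) //= [in RHS](bigD1 a) //= /set_arc eqxx.
rewrite (eq_bigr (fun b => (f b)%:Z * incidence b v)) => [|b /negbTE-> //].
by ring.
Qed.

(** Induction augments along the path from [y] first and then changes the arc between [x] and [y].
    As [x] is off the remaining path, the last clause guarantees that this arc still carries
    [f a]. *)
Lemma augment f x p : (forall a, (f a <= cap a)%N) -> path (residual f) x p -> uniq (x :: p) ->
  exists g, [/\ forall a, (g a <= cap a)%N,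
    forall v, net g v = net f v + ((v == x)%:Z - (v == last x p)%:Z)
    & forall a, (tl a \notin x :: p) || (hd a \notin x :: p) -> g a = f a].
Proof.
move=> fcap; elim: p x => [|y p IH] x.
  by exists f; split=> // v; rewrite subrr addr0.
rewrite [path _ _ _]/= => /andP[rxy pyp]; rewrite cons_uniq => /andP[xyp uyp].
have [g [gcap gnet gE]] := IH y pyp uyp.
have gE' a : (tl a \notin [:: x, y & p]) || (hd a \notin [:: x, y & p]) -> g a = f a.
  by move=> h; apply: gE; case/orP: h => h; apply/orP; [left|right]; apply: contra h => h;
    rewrite inE h orbT.
case/orP: rxy => /existsP[a /and3P[/eqP e1 /eqP e2 fa]].
- have ga : g a = f a by apply: gE; rewrite e1 xyp.
  exists (set_arc g a (f a).+1); split.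
  + by move=> b; rewrite /set_arc; case: eqP => [->|].
  + move=> v; rewrite net_set_arc gnet ga /incidence e1 e2 !(eq_sym _ v) /=.
    have -> : (f a).+1%:Z - (f a)%:Z = 1 by lia.
    by ring.
  move=> b h; rewrite /set_arc; case: eqP => [ba|_]; last exact: gE'.
  by move: h; rewrite ba e1 e2 !inE !eqxx !orbT.
- have ga : g a = f a by apply: gE; rewrite e1 xyp orbT.
  exists (set_arc g a (f a).-1); split.
  + by move=> b; rewrite /set_arc; case: eqP => [->|//]; apply: leq_trans (leq_pred _) (fcap a).
  + move=> v; rewrite net_set_arc gnet ga /incidence e1 e2 !(eq_sym _ v) /=.
    have -> : (f a).-1%:Z - (f a)%:Z = -1 by lia.
    by ring.
  move=> b h; rewrite /set_arc; case: eqP => [ba|_]; last exact: gE'.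
  by move: h; rewrite ba e1 e2 !inE !eqxx !orbT.
Qed.

Definition cut_cap (R : {set V}) : nat := (\sum_(a | (tl a \in R) && (hd a \notin R)) cap a)%N.

(** Summed over [R], only arcs across the boundary contribute; closure under residual steps forces
    those leaving [R] to be full and those entering it to be empty. *)
Lemma saturated_cut f (R : {set V}) : s \in R -> t \notin R -> (forall a, (f a <= cap a)%N) ->
  (forall u v, u \in R -> residual f u v -> v \in R) ->
  \sum_(v in R) net f v = (cut_cap R)%:Z.
Proof.
move=> sR tR fcap Rcl; rewrite /net exchange_big /= /cut_cap.
have inc a : \sum_(v in R) incidence a v = (tl a \in R)%:Z - (hd a \in R)%:Z.
  rewrite /incidence sumrB; congr (_ - _).
    have [aR|aR] := boolP (tl a \in R).
      rewrite (bigD1 (tl a)) //= eqxx big1 ?addr0 // => v /andP[_].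
      by rewrite eq_sym => /negbTE->.
    by rewrite big1 // => v vR; case: eqP aR => // ->; rewrite vR.
  have [aR|aR] := boolP (hd a \in R).
    rewrite (bigD1 (hd a)) //= eqxx big1 ?addr0 // => v /andP[_].
    by rewrite eq_sym => /negbTE->.
  by rewrite big1 // => v vR; case: eqP aR => // ->; rewrite vR.
rewrite (big_morph Posz PoszD (erefl _)) [RHS]big_mkcond /=; apply: eq_bigr => a _.
rewrite -mulr_sumr inc.
have [tR'|tR'] := boolP (tl a \in R); have [hR|hR] := boolP (hd a \in R); rewrite ?subrr ?mulr0 //=.
- rewrite subr0 mulr1; congr Posz; apply/eqP; rewrite eqn_leq fcap leqNgt /=.
  apply/negP => lt; case/negP: hR; apply: Rcl tR' _.
  by apply/orP; left; apply/existsP; exists a; rewrite !eqxx.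
- have -> : f a = 0%N; last by rewrite mul0r.
  apply/eqP; rewrite -leqn0 leqNgt; apply/negP => lt; case/negP: tR'; apply: Rcl hR _.
  by apply/orP; right; apply/existsP; exists a; rewrite !eqxx.
Qed.

(** Max-flow min-cut by augmenting paths, by induction on the value: if [t] is not residually
    reachable, the reachable set is a cut of capacity exactly [N], against the hypothesis for
    [N.+1]. *)
Lemma flow_of_cuts N :
  (forall R : {set V}, s \in R -> t \notin R -> (N <= cut_cap R)%N) -> exists f, is_flow N f.
Proof.
elim: N => [|N IH] cut.
  by exists (fun=> 0%N); split=> // v; rewrite /net big1 ?mul0r // => a _; rewrite mul0r.
have [|f [fcap fnet]] := IH; first by move=> R sR tR; apply: ltnW; apply: cut.
pose R := [set v | connect (residual f) s v].
have sR : s \in R by rewrite inE.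
have [|tR] := boolP (t \in R).
  rewrite inE => /connectP[p0 /shortenP[p pp up _] tE].
  have [g [gcap gnet _]] := augment fcap pp up.
  exists g; split=> // v; rewrite gnet fnet -tE intS; ring.
have Rcl u v : u \in R -> residual f u v -> v \in R.
  by rewrite !inE => su uv; apply: connect_trans su (connect1 uv).
have := saturated_cut sR tR fcap Rcl.
rewrite (bigD1 s) //= fnet eqxx big1 => [|v /andP[vR vs]]; last first.
  rewrite fnet (negbTE vs); case: eqP => [vt|]; last by rewrite subrr mulr0.
  by rewrite vt (negbTE tR) in vR.
have /negbTE -> : s != t by apply: contraNneq tR => <-.
by move=> h; have := cut R sR tR; lia.
Qed.

End Flow.

Lemma feasible_flow k (D : ftp_instance) (S : {set 'I_(narcs D)}) : feasible k S ->
  exists f : 'I_(narcs D) -> nat,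
    [/\ forall a, (0 < f a)%N -> a \in S,
        forall a, a \in vulnerable D -> (f a <= 1)%N
      & forall v, net (@arc_tail D) (@arc_head D) f v =
          (k.+1%:Z * ((v == source D)%:Z - (v == target D)%:Z))%R].
Proof.
(* Capacity [k.+1] acts as infinity: one safe arc of [S] across a cut already gives the cut the
   required capacity. *)
move=> feas; pose cap a := if a \in S then if a \in vulnerable D then 1 else k.+1 else 0.
have [R sR tR|f [fcap fnet]] := @flow_of_cuts _ _ (@arc_tail D) (@arc_head D) cap (source D) (target D) k.+1.
  pose Out := [set a | (arc_tail a \in R) && (arc_head a \notin R)].
  have [/existsP[a /and3P[aS aO av]]|] :=
    boolP [exists a, [&& a \in S, a \in Out & a \notin vulnerable D]].
    rewrite /cut_cap (bigD1 a) /=; last by rewrite inE in aO.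
    by rewrite /cap aS (negbTE av) leq_addr.
  rewrite negb_exists => /forallP nosafe; rewrite leqNgt; apply/negP => lt.
  have vul a : a \in S -> a \in Out -> a \in vulnerable D.
    by move=> aS aO; have := nosafe a; rewrite aS aO negbK.
  (* All arcs of [S] leaving [R] are now vulnerable with capacity 1, so a cut below [k.+1] is an
     admissible fault set, and its removal traps every path from the source in [R]. *)
  have cardF : #|S :&: Out| <= k.
    rewrite -ltnS; apply: leq_trans lt; rewrite ltnS -sum1_card /cut_cap.
    rewrite [leqLHS]big_mkcond [leqRHS]big_mkcond /=; apply: leq_sum => a _.
    rewrite !inE; have [aS|//] := boolP (a \in S); case: ifP => //= aO.
    by rewrite aO /cap aS vul // inE.
  have [|p [pp pl _]] := feas (S :&: Out) _ cardF.
    by apply/subsetP => a; rewrite inE => /andP[aS aO]; apply: vul.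
  have stay x q : x \in R -> path (adj (S :\: (S :&: Out))) x q -> last x q \in R.
    elim: q x => //= y q IH x xR /andP[/existsP[a /and3P[aX /eqP ta /eqP ha]]].
    apply: IH; move: aX; rewrite !inE ta ha xR.
    by case: (a \in S); rewrite //= ?andbF ?negbK ?andbT.
  by case/negP: tR; rewrite -pl; apply: stay pp.
exists f; split=> // a.
  by rewrite lt0n => fa; have := fcap a; rewrite /cap; case: (a \in S) => //; rewrite leqn0 (negbTE fa).
by move=> av; have := fcap a; rewrite /cap av; case: (a \in S) => // /leq_trans->.
Qed.

(** * Values of the encoded numbers *)

Lemma bval_bits_of_nat n : bval (bits_of_nat n) = n.
Proof.
rewrite -[RHS]bin_of_natK /bits_of_nat; case: (bin_of_nat n) => //= p.
elim: p => //= p ->; rewrite NatTrec.doubleE; lia.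
Qed.

Lemma enc_num_inj : injective (@enc _ : num -> tree).
Proof. by apply: enc_seq_inj; apply: enc_bool_inj. Qed.

Lemma tree_of_nat_inj : injective tree_of_nat.
Proof.
by move=> m n /enc_num_inj mn; rewrite -(bval_bits_of_nat m) mn bval_bits_of_nat.
Qed.

Definition cval (c : frac) : rat := ((bval c.1)%:R / (bval c.2)%:R)%R.

Lemma cadd_den_gt0 c w : 0 < bval c.2 -> 0 < bval w.2 -> 0 < bval (cadd c w).2.
Proof. by rewrite /= bval_bmul muln_gt0 => -> ->. Qed.

Lemma cval_cadd c w : 0 < bval c.2 -> 0 < bval w.2 -> cval (cadd c w) = (cval c + cval w)%R.
Proof.
rewrite /cval /= bval_badd !bval_bmul -!(ltr0n rat) => c2 w2.
by rewrite natrD !natrM; field; rewrite !lt0r_neq0.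
Qed.

Lemma cleE c c' : 0 < bval c.2 -> 0 < bval c'.2 -> cle c c' = (cval c <= cval c')%R.
Proof.
rewrite /cle /cval bleE !bval_bmul -!(ltr0n rat) => c2 c2'.
by rewrite ler_pdivrMr // mulrAC ler_pdivlMr // -!natrM ler_nat.
Qed.

Lemma cval_nnrat (q : rat) : (0 <= q)%R ->
  cval (bits_of_nat `|numq q|, bits_of_nat `|denq q|) = q.
Proof.
move=> q0; rewrite /cval /= !bval_bits_of_nat -[RHS]divq_num_den.
have -> : ((absz (numq q))%:R = (numq q)%:~R :> rat)%R by rewrite pmulrn gez0_abs ?numq_ge0.
by have -> : ((absz (denq q))%:R = (denq q)%:~R :> rat)%R by rewrite pmulrn absz_denq.
Qed.

(** Positive denominators make [cle] the order of the values. An entry is dropped only in favour of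
    one with the same key and no greater cost. *)
Lemma insert_dom T e e0 : all (fun x : entry => 0 < bval x.2.1.2) (e :: T) ->
  e0 \in e :: T ->
  exists2 e', e' \in insert T e & e'.1 = e0.1 /\ (cval e'.2.1 <= cval e0.2.1)%R.
Proof.
move=> /= /andP[de /allP dT]; rewrite /insert; case: hasP => [[e' e'T /andP[/eqP k c]]|no].
  rewrite inE => /predU1P[->|e0T]; last by exists e0.
  by exists e' => //; split=> //; rewrite -cleE // dT.
rewrite inE => /predU1P[->|e0T]; first by exists e; rewrite ?inE ?eqxx.
have [kk|kk] := eqVneq e0.1 e.1; last first.
  by exists e0 => //; rewrite inE mem_filter kk e0T orbT.
exists e; rewrite ?inE ?eqxx //; split=> //; rewrite leNgt; apply/negP => lt.
by apply: no; exists e0 => //; rewrite kk eqxx andTb cleE ?(dT _ e0T) //; apply: ltW.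
Qed.

Lemma prune_dom l e : all (fun x : entry => 0 < bval x.2.1.2) l -> e \in l ->
  exists2 e', e' \in prune l & e'.1 = e.1 /\ (cval e'.2.1 <= cval e.2.1)%R.
Proof.
suff gen T : all (fun x : entry => 0 < bval x.2.1.2) (T ++ l) -> e \in T ++ l ->
  exists2 e', e' \in foldl insert T l & e'.1 = e.1 /\ (cval e'.2.1 <= cval e.2.1)%R.
  exact: (gen [::]).
elim: l T e => [|a l IH] T e /=; first by rewrite cats0 => _ eT; exists e.
rewrite all_cat /= => /and3P[dT da dl] eTl.
have daT : all (fun x : entry => 0 < bval x.2.1.2) (a :: T) by rewrite /= da.
have dins : all (fun x : entry => 0 < bval x.2.1.2) (insert T a ++ l).
  by rewrite all_cat dl andbT; apply/allP => x /insert_sub; apply: (allP daT).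
move: eTl; rewrite mem_cat inE orbCA orbA -in_cons => /orP[eaT|el]; last first.
  by apply: IH; rewrite // mem_cat el orbT.
have [e' e'in [k c]] := insert_dom daT eaT.
have [|e2 e2in [k2 c2]] := IH (insert T a) e' dins; first by rewrite mem_cat e'in.
by exists e2 => //; rewrite k2 k; split=> //; apply: le_trans c2 c.
Qed.

(** * Arc identifiers and topological order *)

Lemma itemsE s : items s = [seq drop i s | i <- iota 0 (size s)].
Proof.
rewrite /items; suff -> (l c : seq arc) out :
    (foldl (fun st _ => (behead st.1, st.1 :: st.2)) (c, out) l).2 =
    catrev [seq drop i c | i <- iota 0 (size l)] out by rewrite -/(rev _) revK.
elim: l c out => //= _ l IH c out; rewrite IH drop0; congr catrev.
rewrite -[1]addn0 iotaDl -map_comp; apply: eq_map => i /=.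
by rewrite -drop1 drop_drop addn1.
Qed.

Lemma preimage_seq (T : Type) (U : eqType) (g : T -> U) (l : seq U) :
  (forall y, y \in l -> exists x, y = g x) -> exists l', l = [seq g x | x <- l'].
Proof.
elim: l => [|y l IH] gl; first by exists [::].
have [x ->] := gl y (mem_head _ _); have [|l' ->] := IH.
  by move=> z zl; apply: gl; rewrite inE zl orbT.
by exists (x :: l').
Qed.

Section TopologicalSort.
Variables (rank : item -> nat) (s : seq item).
Hypothesis (rankP : forall x y, x \in s -> y \in s -> ihead y = itail x -> rank y < rank x).

Let before (x y : item) : bool := ihead y != itail x.
Let round (st : seq item * seq item) (_ : item) :=
  ([seq x <- st.1 | ~~ ready st.1 x], st.2 ++ [seq x <- st.1 | ready st.1 x]).

Lemma readyE R x : ready R x = all (before x) R.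
Proof. by rewrite /ready -all_predC. Qed.

(** No remaining item enters the tail of an item already output, hence anything output later may
    follow it. The last clause turns the clock into termination. *)
Lemma rounds_inv l : let st := foldl round (s, [::]) l in
  [/\ perm_eq (st.1 ++ st.2) s, pairwise before st.2, allrel before st.2 st.1
    & size st.1 <= size s - size l].
Proof.
elim/last_ind: l => [|l z IH] /=.
  by rewrite cats0 subn0; split=> //; rewrite allrel0l.
rewrite foldl_rcons; move: IH; case: (foldl _ _ l) => R out /= [pe pw ar sz].
have fl : allrel before [seq x <- R | ready R x] R.
  by apply/allrelP => x y; rewrite mem_filter readyE => /andP[/allP h _] /h.
have sub p : {subset [seq x <- R | p x] <= R} by apply: mem_subseq; apply: filter_subseq.
split.
- apply: perm_trans pe; apply/permP => p.
  have /permP/(_ p) := permEl (perm_filterC (ready R) R); rewrite !count_cat => <-.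
  by rewrite addnCA addnC; congr (_ + _); exact: addnC.
- rewrite pairwise_cat pw; apply/and3P; split=> //.
    by apply/allrelP => x y xo /sub yR; apply: (allrelP ar).
  apply/(pairwiseP [::]) => i j; rewrite !inE => iF jF _.
  by apply: (allrelP fl); [|apply: (sub (ready R))]; apply: mem_nth.
- apply/allrelP => x y; rewrite mem_cat => /orP[xo|xF] /sub yR.
    exact: (allrelP ar).
  exact: (allrelP fl).
rewrite size_rcons size_filter.
case: R pe {pw ar sub fl} sz => [|x0 R0]; first by [].
set R := x0 :: R0 => pe sz.
have Rs : {subset R <= s} by move=> x xR; rewrite -(perm_mem pe) mem_cat xR.
suff : has (ready R) R.
  have -> : count (fun x => ~~ ready R x) R = size R - count (ready R) R.
    by rewrite -(count_predC (ready R) R) addKn.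
  by rewrite has_count; move: (count _ _) (size R) (size s) (size l) sz => c r m n; lia.
(* An item of least rank is ready, because an item entering its tail would have smaller rank. *)
have ex : exists n, has (fun x => rank x == n) R by exists (rank x0); rewrite /= eqxx.
case: (ex_minnP ex) => n /hasP[x xR /eqP rx] minn.
apply/hasP; exists x => //; rewrite readyE; apply/allP => y yR; apply/negP => /eqP yx.
have : n <= rank y by apply: minn; apply/hasP; exists y.
by rewrite -rx leqNgt rankP ?Rs.
Qed.

Lemma tsort_perm : perm_eq (tsort s) s.
Proof.
have [pe _ _] := rounds_inv s; rewrite subnn leqn0 => /eqP/size0nil R0.
by move: pe; rewrite R0.
Qed.

Lemma tsort_pairwise : pairwise before (tsort s).
Proof. by have [] := rounds_inv s. Qed.

End TopologicalSort.

(** * Correctness on acyclic instances *)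

(** The instance is rebuilt from encodable types so that its encoding is [encode_instance D]
    itself. *)
Definition arc_data (D : ftp_instance) (a : 'I_(narcs D)) : arc :=
  (tree_of_nat (arc_tail a), (tree_of_nat (arc_head a), (a \in vulnerable D,
    (bits_of_nat `|numq (weight a)|, bits_of_nat `|denq (weight a)|)))).

Definition arc_list (D : ftp_instance) : seq arc := [seq arc_data a | a <- enum 'I_(narcs D)].

Definition instance_data (D : ftp_instance) : seq tree * (tree * (tree * seq arc)) :=
  ([seq tree_of_nat v | v : 'I_(nverts D) <- enum 'I_(nverts D)],
   (tree_of_nat (source D), (tree_of_nat (target D), arc_list D))).

Lemma tree_of_seq_map (T U : Type) (f : U -> tree) (g : T -> U) (s : seq T) :
  tree_of_seq f [seq g x | x <- s] = tree_of_seq (fun x => f (g x)) s.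
Proof. by rewrite /tree_of_seq foldr_map. Qed.

Lemma enc_instance_data D : enc (instance_data D) = encode_instance D.
Proof.
rewrite /instance_data /arc_list /encode_instance /=; congr (Node _ (Node _ (Node _ _))).
  exact: tree_of_seq_map.
exact: tree_of_seq_map.
Qed.

Section Correctness.
Variables (k : nat) (D : ftp_instance).
Hypothesis acyc : acyclic D.
Notation arcs := 'I_(narcs D).
Notation verts := 'I_(nverts D).
Implicit Types (a b : arcs) (u v : verts).

Let tv (v : verts) : tree := tree_of_nat v.

Lemma tv_inj : injective tv.
Proof. by move=> u v /tree_of_nat_inj/val_inj. Qed.

Let edge : rel verts := adj [set: arcs].

Lemma edge_arc a : edge (arc_tail a) (arc_head a).
Proof. by apply/existsP; exists a; rewrite inE !eqxx. Qed.

Definition vrank v : nat := #|[set w | connect edge w v]|.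

(** Ancestors of the tail are ancestors of the head. The head itself is a new one, as a path from it
    to the tail would close a cycle with the arc. *)
Lemma vrank_arc a : vrank (arc_tail a) < vrank (arc_head a).
Proof.
apply: proper_card; apply/properP; split.
  by apply/subsetP => w; rewrite !inE => wt; apply: connect_trans wt (connect1 (edge_arc a)).
exists (arc_head a); rewrite inE ?connect0 //; apply/negP => /connectP[p0 /shortenP[p pp up _] pl].
have : ucycle edge (arc_head a :: p).
  by rewrite /ucycle up andbT /= rcons_path pp -pl edge_arc.
by move/acyc.
Qed.

Definition sfx a : item := drop a (arc_list D).

Lemma size_arc_list : size (arc_list D) = narcs D.
Proof. by rewrite size_map size_enum_ord. Qed.

Lemma items_arc_list : items (arc_list D) = [seq sfx a | a <- enum arcs].
Proof. by rewrite itemsE size_arc_list -val_enum_ord -map_comp. Qed.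

Lemma head_sfx a : head arc0 (sfx a) = arc_data a.
Proof.
by rewrite -nth0 nth_drop addn0 (nth_map a) ?size_enum_ord // nth_ord_enum.
Qed.

Lemma sfx_inj : injective sfx.
Proof.
move=> a b /(congr1 size); rewrite !size_drop size_arc_list => e; apply/val_inj.
have := ltn_ord a; have := ltn_ord b; move: e; rewrite /=; lia.
Qed.

Lemma itail_sfx a : itail (sfx a) = tv (arc_tail a).
Proof. by rewrite /itail head_sfx. Qed.

Lemma ihead_sfx a : ihead (sfx a) = tv (arc_head a).
Proof. by rewrite /ihead head_sfx. Qed.

Lemma ivul_sfx a : ivul (sfx a) = (a \in vulnerable D).
Proof. by rewrite /ivul head_sfx. Qed.

Lemma iwgt_sfx_den a : 0 < bval (iwgt (sfx a)).2.
Proof. by rewrite /iwgt head_sfx /= bval_bits_of_nat absz_gt0 denq_neq0. Qed.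

Lemma cval_sfx a : cval (iwgt (sfx a)) = weight a.
Proof. by rewrite /iwgt head_sfx /= cval_nnrat // weight_ge0. Qed.

Lemma tsort_arcs : exists l : seq arcs,
  [/\ tsort (items (arc_list D)) = [seq sfx a | a <- l], perm_eq l (enum arcs)
    & pairwise (fun a b => arc_head b != arc_tail a) l].
Proof.
pose rank (x : item) := if [pick a | sfx a == x] is Some a then vrank (arc_tail a) else 0.
have rankE a : rank (sfx a) = vrank (arc_tail a).
  by rewrite /rank; case: pickP => [b /eqP/sfx_inj->//|/(_ a)]; rewrite eqxx.
have rankP x y : x \in items (arc_list D) -> y \in items (arc_list D) ->
    ihead y = itail x -> rank y < rank x.
  rewrite items_arc_list => /mapP[a _ ->] /mapP[b _ ->].
  by rewrite ihead_sfx itail_sfx !rankE => /tv_inj <-; apply: vrank_arc.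
have pe := tsort_perm rankP; have pw := tsort_pairwise rankP.
have [|l lE] := @preimage_seq _ _ sfx (tsort (items (arc_list D))).
  by move=> y; rewrite (perm_mem pe) items_arc_list => /mapP[a _ ->]; exists a.
exists l; split=> //.
  by apply: (perm_map_inj sfx_inj); rewrite -lE -items_arc_list.
move: pw; rewrite lE pairwise_map; apply: sub_pairwise => a b /=.
by rewrite ihead_sfx itail_sfx (inj_eq tv_inj).
Qed.

Let table (l : seq arcs) := dp k.+1 (tv (source D)) [seq sfx a | a <- l].

Lemma table_rcons l a : table (rcons l a) = tstep k.+1 (table l) (sfx a).
Proof. by rewrite /table map_rcons /dp foldl_rcons. Qed.

(* The last clause bounds the tokens that have left a set R of positions which only
   the arcs of F leave: each arc of F lets at most one token out. *)
Definition sound_entry (l : seq arcs) (e : entry) : Prop :=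
  exists ch : seq arcs,
    [/\ e.2.2 = [seq sfx a | a <- ch], uniq ch, {subset ch <= l},
        [/\ size e.1 = k.+1, 0 < bval e.2.1.2 & cval e.2.1 = (\sum_(a <- ch) weight a)%R]
      & forall (F : {set arcs}) (R : pred tree), F \subset vulnerable D ->
          R (tv (source D)) ->
          (forall a, a \in ch -> a \notin F -> R (tv (arc_tail a)) -> R (tv (arc_head a))) ->
          count (predC R) e.1 <= count [in F] ch].

(** For the cut clause, moving along [a] raises the count outside [R] only if [a] leaves [R]. Then
    [a] lies in [F] and is vulnerable, so at most one token crosses while the count of arcs of [F]
    grows by one. *)
Lemma table_sound l e : uniq l -> e \in table l -> sound_entry l e.
Proof.
elim/last_ind: l e => [|l a IH] e ul.
  rewrite inE => /eqP->; exists [::]; split=> //=.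
    by rewrite size_nseq big_nil /cval /= mul0r.
  by move=> F R _ Rs _; rewrite count_nseq /= Rs.
rewrite rcons_uniq in ul; case/andP: ul => al ul.
rewrite table_rcons => /prune_sub; rewrite mem_cat => /orP[/(IH _ ul)|].
  move=> [ch [eE uch sub ok cl]]; exists ch; split=> // b /sub.
  by rewrite mem_rcons inE => ->; rewrite orbT.
case/flattenP => _ /mapP[e0 /(IH _ ul)[ch [eE uch sub [sz den val] cl]] ->] /mapP[p pm ->].
have [j [jc jv] mv] := moves_sound sz pm; exists (a :: ch); split=> /=.
- by rewrite eE.
- by rewrite uch andbT; apply: contra al => /sub.
- by move=> b; rewrite mem_rcons !inE => /orP[->//|/sub->]; rewrite orbT.
- split; first by rewrite (moved_size mv).
    by apply: (cadd_den_gt0 den); apply: iwgt_sfx_den.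
  by rewrite (cval_cadd den (iwgt_sfx_den a)) val cval_sfx big_cons addrC.
move=> F R Fv Rs Rcl.
have cl0 : count (predC R) e0.1 <= count [in F] ch.
  by apply: cl => // b bch; apply: Rcl; rewrite inE bch orbT.
have := mv (predC R); move: cl0; rewrite itail_sfx ihead_sfx.
move: (count (predC R) e0.1) (count (predC R) p.2) (count [in F] ch) => c0 c1 c2 /=.
have := Rcl a (mem_head _ _).
have [Rh|Rh] := boolP (R (tv (arc_head a))); first by lia.
have [Rt|Rt] := boolP (R (tv (arc_tail a))); last by lia.
have [aF _|aF h] := boolP (a \in F); last by have := h isT isT.
have : j <= 1 by apply: jv; rewrite ivul_sfx (subsetP Fv).
by rewrite /=; lia.
Qed.

Lemma candidates_den_gt0 l a : uniq l -> all (fun x : entry => 0 < bval x.2.1.2)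
  (table l ++ flatten [seq expand k.+1 (sfx a) e | e <- table l]).
Proof.
move=> ul; apply/allP => e; rewrite mem_cat => /orP[/(table_sound ul)[ch [_ _ _ []]] //|].
case/flattenP => _ /mapP[e0 /(table_sound ul)[ch [_ _ _ [_ den _] _]] ->] /mapP[p _ ->].
by apply: (cadd_den_gt0 den); apply: iwgt_sfx_den.
Qed.

(** * Steering the dynamic program along a given flow *)

Section Completeness.
Variables (f : arcs -> nat) (l : seq arcs).
Hypotheses (fvul : forall a, a \in vulnerable D -> f a <= 1).
Hypothesis (fnet : forall v, net (@arc_tail D) (@arc_head D) f v =
  (k.+1%:Z * ((v == source D)%:Z - (v == target D)%:Z))%R).
Hypotheses (lperm : perm_eq l (enum arcs))
  (ltopo : pairwise (fun a b => arc_head b != arc_tail a) l).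

Let inc := incidence (@arc_tail D) (@arc_head D).

Lemma sum_net v : (\sum_(a <- l) (f a)%:Z * inc a v)%R =
  (k.+1%:Z * ((v == source D)%:Z - (v == target D)%:Z))%R.
Proof. by rewrite (perm_big _ lperm) /= big_enum -fnet. Qed.

(** The counts are those after sending [f a] tokens along each arc of [l1]. Only key and cost are
    mentioned, so the property survives replacement by a cheaper entry with the same key. *)
Definition tracks (l1 : seq arcs) (e : entry) : Prop :=
  (forall v, (count_mem (tv v) e.1)%:Z =
     k.+1%:Z * (v == source D)%:Z - \sum_(a <- l1) (f a)%:Z * inc a v)%R
  /\ (cval e.2.1 <= \sum_(a <- l1 | (0 < f a)%N) weight a)%R.

(* All arcs into the tail of a precede a, so by conservation enough tokens wait there. *)
Lemma tokens_available l1 a l2 e : l = l1 ++ a :: l2 -> tracks l1 e ->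
  f a <= count_mem (tv (arc_tail a)) e.1.
Proof.
move=> lE [cnt _]; rewrite -lez_nat cnt; have := sum_net (arc_tail a).
rewrite lE big_cat big_cons /= {2}/inc /incidence eqxx.
have -> : (arc_head a == arc_tail a) = false.
  by apply/eqP => e0; have := vrank_arc a; rewrite e0 ltnn.
have : (0 <= \sum_(b <- l2) (f b)%:Z * inc b (arc_tail a))%R.
  rewrite big_seq; apply: sumr_ge0 => b bl; apply: mulr_ge0 => //.
  move: ltopo; rewrite lE pairwise_cat pairwise_cons => /and4P[_ _ /allP/(_ b bl) /negbTE hb _].
  by rewrite /inc /incidence hb subr0.
move: (\sum_(b <- l2) _)%R (\sum_(b <- l1) _)%R => x y.
by case: (_ == source D); case: (_ == target D); lia.
Qed.

(** The tracking entry is kept if [f a] is 0 and otherwise moved by [f a] tokens. Pruning may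
    discard this candidate, but [prune_dom] supplies a replacement that still tracks the flow. *)
Lemma table_complete l1 l2 : l = l1 ++ l2 -> exists2 e, e \in table l1 & tracks l1 e.
Proof.
elim/last_ind: l1 l2 => [|l1 a IH] l2 lE.
  exists (nseq k.+1 (tv (source D)), (([::], [:: true]), [::])); first by rewrite inE.
  split=> [v|]; last by rewrite big_nil /cval mul0r.
  by rewrite big_nil subr0 count_nseq /= (inj_eq tv_inj) eq_sym; case: eqP; lia.
rewrite cat_rcons in lE; have [e eT tr] := IH _ lE; have avail := tokens_available lE tr.
have ul1 : uniq l1.
  by have := perm_uniq lperm; rewrite enum_uniq lE cat_uniq => /and3P[].
have [cnt val] := tr.
suff [e1 e1c [cnt1 val1]] : exists2 e1,
    e1 \in table l1 ++ flatten [seq expand k.+1 (sfx a) e | e <- table l1] & tracks (rcons l1 a) e1.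
  have [e2 e2T [key2 val2]] := prune_dom (candidates_den_gt0 a ul1) e1c.
  exists e2; first by rewrite table_rcons.
  by split=> [v|]; [rewrite key2|apply: le_trans val2 val1].
have [fa0|fa0] := posnP (f a).
  exists e; first by rewrite mem_cat eT.
  by split=> [v|]; rewrite -cats1 big_cat big_cons big_nil /= ?fa0 ?mul0r !addr0.
have [ch [_ _ _ [sz den _] _]] := table_sound ul1 eT.
have [||p pm mv] := @moves_complete k.+1 (sfx a) e.1 (f a) sz.
- by rewrite itail_sfx.
- by rewrite ivul_sfx; apply: fvul.
exists (p.2, (cadd e.2.1 (iwgt (sfx a)), sfx a :: e.2.2)).
  by rewrite mem_cat; apply/orP; right; apply/flattenP; exists (expand k.+1 (sfx a) e);
    [apply: map_f|apply/mapP; exists p].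
split=> [v|]; rewrite -cats1 big_cat big_cons big_nil /= ?fa0 addr0; last first.
  by rewrite cval_cadd // ?iwgt_sfx_den // cval_sfx lerD2r.
have := mv (pred1 (tv v)); rewrite itail_sfx ihead_sfx /= !(inj_eq tv_inj).
move: (cnt v); move: (k.+1%:Z * _)%R (\sum_(b <- l1) _)%R (count _ e.1) (count _ p.2) => w x y z.
rewrite /inc /incidence.
by case: (arc_tail a == v); case: (arc_head a == v); lia.
Qed.

(** After all arcs, conservation leaves [k.+1] tokens at the target, which is the length of the
    key. *)
Lemma final_entry : exists2 e, e \in table l &
  e.1 = nseq k.+1 (tv (target D)) /\ (cval e.2.1 <= \sum_(a | (0 < f a)%N) weight a)%R.
Proof.
have [|e eT [cnt val]] := @table_complete l [::]; first by rewrite cats0.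
exists e => //; split; last by move: val; rewrite (perm_big _ lperm) /= big_enum_cond.
have ul : uniq l by rewrite (perm_uniq lperm) enum_uniq.
have [ch [_ _ _ [sz _ _] _]] := table_sound ul eT.
have : count_mem (tv (target D)) e.1 = size e.1.
  apply/eqP; rewrite -eqz_nat cnt sum_net eqxx sz; apply/eqP.
  by case: (_ == source D); lia.
move/eqP; rewrite -all_count => /all_pred1P; rewrite sz; exact.
Qed.

End Completeness.

(** * Feasibility and optimality of the answer *)

Lemma sound_feasible l e : sound_entry l e -> e.1 = nseq k.+1 (tv (target D)) ->
  feasible k [set a | sfx a \in e.2.2].
Proof.
move=> [ch [eE uch _ [_ _ _] cl]] key F Fv Fk; rewrite eE.
have mem_ch a : (sfx a \in [seq sfx b | b <- ch]) = (a \in ch) by rewrite mem_map //; apply: sfx_inj.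
set X := _ :\: F.
have [st|nst] := boolP (connect (adj X) (source D) (target D)).
  by case/connectP: st => p0 /shortenP[p pp up _] pl; exists p; split.
(* [R] holds the positions reachable after the faults, as a predicate on trees since tokens are
   encoded vertices. If the target is not among them, all [k.+1] tokens have left [R]. *)
pose R : pred tree := fun x => [exists v, connect (adj X) (source D) v && (x == tv v)].
have RE v : R (tv v) = connect (adj X) (source D) v.
  apply/existsP/idP => [[w /andP[cw /eqP/tv_inj->]]|cv] //.
  by exists v; rewrite cv eqxx.
have : count (predC R) e.1 <= count [in F] ch.
  apply: cl => //; first by rewrite RE connect0.
  move=> a ach aF; rewrite !RE => ct; apply: connect_trans ct (connect1 _).
  by apply/existsP; exists a; rewrite !inE mem_ch ach aF !eqxx.
rewrite key count_nseq -[predC R _]/(~~ R _) RE nst mul1n.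
rewrite -size_filter => le.
suff : size [seq x <- ch | x \in F] <= #|F| by move/(leq_trans le); rewrite leqNgt ltnS Fk.
rewrite cardE; apply: uniq_leq_size; first exact: filter_uniq.
by move=> x; rewrite mem_filter mem_enum => /andP[].
Qed.

Lemma sound_weight l e : sound_entry l e ->
  total_weight [set a | sfx a \in e.2.2] = cval e.2.1.
Proof.
move=> [ch [eE uch _ [_ _ ->] _]]; rewrite /total_weight big_uniq //=.
by apply: eq_bigl => a; rewrite inE eE mem_map //; apply: sfx_inj.
Qed.

Lemma uniq_key_inj (T : seq entry) e e' : uniq [seq x.1 | x <- T] ->
  e \in T -> e' \in T -> e.1 = e'.1 -> e = e'.
Proof.
elim: T => //= x T IH /andP[xT uT]; rewrite !inE => /predU1P[->|eT] /predU1P[->|e'T] //.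
- by move=> k1; case/negP: xT; rewrite k1 map_f.
- by move=> k1; case/negP: xT; rewrite -k1 map_f.
- exact: IH.
Qed.

Lemma solve_correct : ftp_solution k D (enc (solve k.+1 (instance_data D))).
Proof.
have [l [lE lperm ltopo]] := tsort_arcs.
have ul : uniq l by rewrite (perm_uniq lperm) enum_uniq.
have opt (S : {set arcs}) : feasible k S -> exists2 e, e \in finals k.+1 (tv (target D)) (table l) &
    (cval e.2.1 <= total_weight S)%R.
  move=> /feasible_flow[f [fS fvul fnet]].
  have [e eT [key val]] := final_entry fvul fnet lperm ltopo.
  exists e; first by rewrite mem_filter key eqxx.
  (* Arcs of [S] without flow only add nonnegative weight. *)
  apply: le_trans val _; rewrite /total_weight [leRHS](bigID (fun a => 0 < f a)) /=.
  rewrite (eq_bigl (fun a => (a \in S) && (0 < f a))) => [|a]; last first.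
    by case: (boolP (0 < f a)) => [/fS->|]; rewrite ?andbF.
  by rewrite lerDl sumr_ge0 // => a _; apply: weight_ge0.
have solveE : solve k.+1 (instance_data D) =
    if nilp (finals k.+1 (tv (target D)) (table l)) then None
    else Some [seq sfx a \in (head entry0 (finals k.+1 (tv (target D)) (table l))).2.2
              | a <- enum arcs].
  rewrite /solve [(instance_data D).2.2.2]/(arc_list D) lE items_arc_list -map_comp.
  case: ifP => // _; congr Some; apply: eq_map => a /=.
  by rewrite has_pred1.
rewrite {}solveE.
case TE: (finals k.+1 (tv (target D)) (table l)) opt => [|e T] opt.
  by right; split=> // S /opt[].
left; have : e \in finals k.+1 (tv (target D)) (table l) by rewrite TE mem_head.
rewrite mem_filter => /andP[/eqP key eT]; have se := table_sound ul eT.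
exists [set a | sfx a \in e.2.2]; split.
  split; first exact: sound_feasible se key.
  move=> S /opt[e']; rewrite -TE mem_filter => /andP[/eqP key' e'T] le.
  (* Keys in the table are distinct, so the entry obtained from [S] is the very entry that is
     returned. *)
  rewrite (sound_weight se) (@uniq_key_inj (table l) e e') ?key ?key' //.
  by case: (dp_ok k.+1 (tv (source D)) (esym (cats0 [seq sfx a | a <- l]))).
rewrite /encode_answer; congr Node; rewrite /= tree_of_seq_map.
by elim: (enum arcs) => //= a s ->; rewrite inE.
Qed.

End Correctness.

Theorem theorem8 (k : nat) :
  poly_time_solvable encode_instance acyclic (ftp_solution k).
Proof.
have [c [N [t [[b [d tb]] run]]]] := PT_solve k.+1.
(* An encoding has positive size [m], so [m.+1 ^ d] is at most [2 ^ d * m ^ d]. *)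
exists c, (b * 2 ^ d), d => D acyc.
have [n [s [ex le [out _]]]] := run (instance_data D) (init_store (encode_instance D))
  (esym (enc_instance_data D)).
exists n, (enc (solve k.+1 (instance_data D))); split; last exact: solve_correct.
  by exists s.
apply: leq_trans le _; apply: leq_trans (tb _) _.
rewrite /esize enc_instance_data; apply: leq_trans (leq_addr _ _).
rewrite -mulnA leq_mul2l -expnMn; apply/orP; right; case: (d) => // d'.
by rewrite leq_exp2r //; have := tree_size_gt0 (encode_instance D); lia.
Qed.
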